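(* Let $G$ and $H$ be countable discrete groups. (1) The following are equivalent: - there exists a coarse embedding $G \to H$; - there exist Kakutani equivalent topologically free topological dynamical systems $G \curvearrowright X$ and $H \curvearrowright Y$, with $X$ compact; - there is a continuous orbit couple for topologically free topological dynamical systems $G \curvearrowright X$ and $H \curvearrowright Y$, with $X$ compact. (2) The following are equivalent: - there is a coarse equivalence $G \to H$; - there are Kakutani equivalent topologically free topological dynamical systems $G \curvearrowright X$ and $H \curvearrowright Y$ on compact spaces $X$ and $Y$; - there is a continuous orbit couple for topologically free topological dynamical systems $G \curvearrowright X$ and $H \curvearrowright Y$, with $X$ and $Y$ compact. (3) There is a bijective coarse equivalence $G \to H$ if and only if there exist continuously orbit equivalent topologically free topological dynamical systems $G \curvearrowright X$ and $H \curvearrowright Y$ on compact spaces $X$ and $Y$. In all these statements, the spaces $X$ and $Y$ can be chosen to be totally disconnected and second countable.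
   Context: A map $\varphi: G \to H$ between groups is a coarse map if $\varphi^{-1}(\{y\})$ is finite for all $y \in H$ and for every $S \subseteq G \times G$ with $\{st^{-1} : (s,t) \in S\}$ finite, $\{\varphi(s)\varphi(t)^{-1} : (s,t)\in S\}$ is finite. It is a coarse embedding if for every $S \subseteq G\times G$, $\{st^{-1} : (s,t) \in S\}$ is finite if and only if $\{\varphi(s)\varphi(t)^{-1} : (s,t)\in S\}$ is finite. Maps $\varphi,\phi: G \to H$ are close ($\varphi\sim\phi$) if $\{\varphi(x)\phi(x)^{-1} : x \in G\}$ is finite. A coarse map $\varphi: G\to H$ is a coarse equivalence if there is a coarse map $\psi: H \to G$ with $\psi\circ\varphi \sim \mathrm{id}_G$ and $\varphi\circ\psi\sim \mathrm{id}_H$. All spaces are Hausdorff. A topological dynamical system $G \curvearrowright X$ is an action of a group $G$ on a locally compact space $X$ by homeomorphisms, written $(g,x)\mapsto g.x$. It is topologically free if for every $g \neq e$ the set $\{x \in X : g.x \neq x\}$ is dense in $X$. A continuous map $p: X \to Y$ is a continuous orbit map (for $G\curvearrowright X$, $H\curvearrowright Y$) if there is a continuous map $a: G\times X \to H$ with $p(g.x) = a(g,x).p(x)$ for all $g\in G$, $x\in X$. A continuous orbit couple for $G\curvearrowright X$ and $H\curvearrowright Y$ consists of continuous orbit maps $p: X\to Y$ and $q: Y \to X$ for which there are continuous maps $g: X\to G$ and $h: Y\to H$ with $q(p(x)) = g(x).x$ and $p(q(y)) = h(y).y$ for all $x\in X$, $y\in Y$. The systems are continuously orbit equivalent if there is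 a continuous orbit couple with $q\circ p=\mathrm{id}_X$, $p\circ q = \mathrm{id}_Y$. The transformation groupoid $X\rtimes G$ is the space $X\times G$ with $r(x,g)=x$, $s(x,g)=g^{-1}.x$, $(x,g)(g^{-1}.x,g')=(x,gg')$. For a subset $A$ of $X$, $(X\rtimes G)|A = s^{-1}(A)\cap r^{-1}(A)$. $G\curvearrowright X$ and $H\curvearrowright Y$ are Kakutani equivalent if there are clopen subsets $A\subseteq X$, $B\subseteq Y$ with $G.A = X$, $H.B=Y$ and $(X\rtimes G)|A\cong (Y\rtimes H)|B$ as topological groupoids. *)

(* Defs.v *)
From HB Require Import structures.
From mathcomp Require Import all_boot monoid all_classical topology.

Set Implicit Arguments.
Unset Strict Implicit.
Unset Printing Implicit Defensive.

Local Open Scope classical_set_scope.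
Local Open Scope group_scope.

Section Coarse.
Variables G H : groupType.
Implicit Types phi : G -> H.

Definition coarse_map phi :=
  (forall y, finite_set (phi @^-1` [set y])) /\
  (forall S : set (G * G),
    finite_set [set st.1 * st.2^-1 | st in S] ->
    finite_set [set phi st.1 * (phi st.2)^-1 | st in S]).

Definition coarse_embedding phi :=
  forall S : set (G * G),
    finite_set [set st.1 * st.2^-1 | st in S] <->
    finite_set [set phi st.1 * (phi st.2)^-1 | st in S].

Definition close_maps phi psi :=
  finite_set [set phi x * (psi x)^-1 | x in [set: G]].

End Coarse.

Definition coarse_equivalence (G H : groupType) (phi : G -> H) :=
  coarse_map phi /\
  exists psi : H -> G, [/\ coarse_map psi,
    close_maps (psi \o phi) id & close_maps (phi \o psi) id].

Definition homeomorphism (X Y : topologicalType) (f : X -> Y) :=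
  continuous f /\
  exists f' : Y -> X, [/\ continuous f', cancel f f' & cancel f' f].

(* The phase space is required to be nonempty: every group acts topologically
   freely on the empty space, and any two such actions are continuously orbit
   equivalent. *)
Record dynsys (G : groupType) := DynSys {
  phase :> topologicalType;
  act : G -> phase -> phase;
  phase_nonempty : [set: phase] !=set0;
  phase_hausdorff : hausdorff_space phase;
  phase_locally_compact : locally_compact [set: phase];
  act1 : forall x, act 1 x = x;
  actM : forall g h x, act (g * h) x = act g (act h x);
  act_homeo : forall g, homeomorphism (act g)
}.

Definition topologically_free (G : groupType) (X : dynsys G) :=
  forall g : G, g <> 1 -> dense [set x : X | act g x <> x].

(* Maps into or out of a group are continuous for its discrete topology. *)
Section OrbitMaps.
Variables G H : groupType.
Variables (X : dynsys G) (Y : dynsys H).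

Definition continuous_orbit_map (p : X -> Y) :=
  continuous p /\
  exists a : discrete_topology G * X -> discrete_topology H,
    continuous a /\ forall (g : G) x, p (act g x) = act (a (g, x)) (p x).

End OrbitMaps.

Section OrbitCouples.
Variables G H : groupType.
Variables (X : dynsys G) (Y : dynsys H).

Definition orbit_couple (p : X -> Y) (q : Y -> X) :=
  [/\ continuous_orbit_map p, continuous_orbit_map q,
      exists g : X -> discrete_topology G,
        continuous g /\ forall x, q (p x) = act (g x) x &
      exists h : Y -> discrete_topology H,
        continuous h /\ forall y, p (q y) = act (h y) y].

Definition has_orbit_couple :=
  exists (p : X -> Y) (q : Y -> X), orbit_couple p q.

Definition orbit_equivalent :=
  exists (p : X -> Y) (q : Y -> X),
    [/\ orbit_couple p q, cancel p q & cancel q p].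

End OrbitCouples.

Record topGroupoid := TopGroupoid {
  arrow :> topologicalType;
  obj : topologicalType;
  rng : arrow -> obj;
  src : arrow -> obj;
  gunit : obj -> arrow;
  gmul : forall a b : arrow, src a = rng b -> arrow;
  ginv : arrow -> arrow;
  rng_gunit : forall x, rng (gunit x) = x;
  src_gunit : forall x, src (gunit x) = x;
  rng_gmul : forall a b (ab : src a = rng b), rng (gmul ab) = rng a;
  src_gmul : forall a b (ab : src a = rng b), src (gmul ab) = src b;
  rng_ginv : forall a, rng (ginv a) = src a;
  src_ginv : forall a, src (ginv a) = rng a;
  gmulA : forall a b c (ab : src a = rng b) (bc : src b = rng c)
    (abc : src (gmul ab) = rng c) (abc' : src a = rng (gmul bc)),
    gmul abc = gmul abc';
  gmul1l : forall a (e : src (gunit (rng a)) = rng a), gmul e = a;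
  gmul1r : forall a (e : src a = rng (gunit (src a))), gmul e = a;
  gmulV : forall a (e : src a = rng (ginv a)), gmul e = gunit (rng a);
  gmulVl : forall a (e : src (ginv a) = rng a), gmul e = gunit (src a);
  rng_continuous : continuous rng;
  src_continuous : continuous src;
  gunit_continuous : continuous gunit;
  ginv_continuous : continuous ginv;
  gmul_continuous :
    continuous (fun ab : [set ab : arrow * arrow | src ab.1 = rng ab.2] =>
      gmul (set_mem (valP ab)))
}.

Definition groupoid_isomorphic (K L : topGroupoid) :=
  exists (phi : K -> L) (phi0 : obj K -> obj L),
    [/\ homeomorphism phi, homeomorphism phi0,
        forall a, rng (phi a) = phi0 (rng a),
        forall a, src (phi a) = phi0 (src a) &
        forall (a b : K) (ab : src a = rng b) (ab' : src (phi a) = rng (phi b)),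
          phi (gmul ab) = gmul ab'].

Lemma continuous_prod_discrete (X Z : topologicalType) (T : choiceType)
    (f : X * discrete_topology T -> Z) :
  (forall t : T, continuous (fun x => f (x, t))) -> continuous f.
Proof.
move=> cf [x t] U /= fU.
exists ((fun y => f (y, t)) @^-1` U, [set t]).
  by split=> /=; [exact: cf | exact: discrete_set1].
by move=> [y s] /= [fy ->].
Qed.

Lemma continuous_set_type (X Z : topologicalType) (A : set X) (f : Z -> A) :
  continuous (fun z => val (f z)) -> continuous f.
Proof.
move=> /continuousP cf; apply/continuousP => _ [U oU <-].
exact: cf oU.
Qed.

Lemma val_continuous (X : topologicalType) (A : set X) :
  continuous (val : A -> X).
Proof. exact: initial_continuous. Qed.

Lemma continuous_pair (X Y Z : topologicalType) (f : Z -> X) (g : Z -> Y) :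
  continuous f -> continuous g -> continuous (fun z => (f z, g z)).
Proof. by move=> cf cg z; apply: cvg_pair; [exact: cf | exact: cg]. Qed.

Lemma continuous_fst (X Y Z : topologicalType) (f : Z -> X * Y) :
  continuous f -> continuous (fun z => (f z).1).
Proof. by move=> cf z; apply: continuous_comp (cf z) _; exact: cvg_fst. Qed.

Lemma continuous_snd (X Y Z : topologicalType) (f : Z -> X * Y) :
  continuous f -> continuous (fun z => (f z).2).
Proof. by move=> cf z; apply: continuous_comp (cf z) _; exact: cvg_snd. Qed.

Section TransformationGroupoid.
Variables (G : groupType) (X : dynsys G).

Definition tg_arrow : topologicalType := (X * discrete_topology G)%type.

Definition tg_rng (a : tg_arrow) : X := a.1.
Definition tg_src (a : tg_arrow) : X := act (a.2 : G)^-1 a.1.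
Definition tg_unit (x : X) : tg_arrow := (x, 1 : G).
Definition tg_mul (a b : tg_arrow) & tg_src a = tg_rng b : tg_arrow :=
  (a.1, (a.2 : G) * (b.2 : G)).
Definition tg_inv (a : tg_arrow) : tg_arrow := (tg_src a, (a.2 : G)^-1).

Lemma act_continuous (g : G) : continuous (act g : X -> X).
Proof. by case: (@act_homeo G X g). Qed.

Lemma tg_rng_unit x : tg_rng (tg_unit x) = x.
Proof. by []. Qed.

Lemma tg_src_unit x : tg_src (tg_unit x) = x.
Proof. by rewrite /tg_src /= invg1 act1. Qed.

Lemma tg_rng_mul a b (ab : tg_src a = tg_rng b) :
  tg_rng (tg_mul ab) = tg_rng a.
Proof. by []. Qed.

Lemma tg_rng_inv a : tg_rng (tg_inv a) = tg_src a.
Proof. by []. Qed.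

Lemma tg_src_mul a b (ab : tg_src a = tg_rng b) :
  tg_src (tg_mul ab) = tg_src b.
Proof. by rewrite /tg_src /= invgM actM -/(tg_src a) ab. Qed.

Lemma tg_src_inv a : tg_src (tg_inv a) = tg_rng a.
Proof. by rewrite /tg_src /tg_inv /= /tg_src -actM mulVg act1. Qed.

Lemma tg_mulA a b c (ab : tg_src a = tg_rng b) (bc : tg_src b = tg_rng c)
    (abc : tg_src (tg_mul ab) = tg_rng c)
    (abc' : tg_src a = tg_rng (tg_mul bc)) :
  tg_mul abc = tg_mul abc'.
Proof. by rewrite /tg_mul /= mulgA. Qed.

Lemma tg_mul1l a (e : tg_src (tg_unit (tg_rng a)) = tg_rng a) :
  tg_mul e = a.
Proof. by case: a e => x g e; rewrite /tg_mul /= mul1g. Qed.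

Lemma tg_mul1r a (e : tg_src a = tg_rng (tg_unit (tg_src a))) :
  tg_mul e = a.
Proof. by case: a e => x g e; rewrite /tg_mul /= mulg1. Qed.

Lemma tg_mulV a (e : tg_src a = tg_rng (tg_inv a)) :
  tg_mul e = tg_unit (tg_rng a).
Proof. by rewrite /tg_mul /= mulgV. Qed.

Lemma tg_mulVl a (e : tg_src (tg_inv a) = tg_rng a) :
  tg_mul e = tg_unit (tg_src a).
Proof. by rewrite /tg_mul /= mulVg. Qed.

Lemma tg_rng_continuous : continuous tg_rng.
Proof. by apply: continuous_fst => x; exact: cvg_id. Qed.

Lemma tg_src_continuous : continuous tg_src.
Proof.
by apply: continuous_prod_discrete => t; exact: (@act_continuous (t : G)^-1).
Qed.

Lemma tg_unit_continuous : continuous tg_unit.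
Proof.
apply: continuous_pair => x; first exact: cvg_id.
exact: (@cst_continuous _ (discrete_topology G)).
Qed.

Lemma discrete_continuous (T : choiceType) (Z : topologicalType)
    (f : discrete_topology T -> Z) : continuous f.
Proof. by apply/continuousP => A _; exact: discrete_open. Qed.

Lemma tg_inv_continuous : continuous tg_inv.
Proof.
apply: continuous_pair; first exact: tg_src_continuous.
apply: continuous_prod_discrete => t.
by move=> x; exact: (@cst_continuous _ (discrete_topology G)).
Qed.

Lemma tg_mul_continuous :
  continuous (fun ab : [set ab : tg_arrow * tg_arrow |
      tg_src ab.1 = tg_rng ab.2] => tg_mul (set_mem (valP ab))).
Proof.
have cv := @val_continuous _ [set ab : tg_arrow * tg_arrow |
  tg_src ab.1 = tg_rng ab.2].
apply: continuous_pair; first exact/continuous_fst/continuous_fst.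
pose m (gh : discrete_topology G * discrete_topology G) :
  discrete_topology G := (gh.1 : G) * (gh.2 : G).
have cm : continuous m.
  by apply: continuous_prod_discrete => h; exact: discrete_continuous.
move=> ab; apply: (@continuous_comp _ _ _
  (fun ab : [set ab : tg_arrow * tg_arrow | tg_src ab.1 = tg_rng ab.2] =>
     ((val ab).1.2, (val ab).2.2)) m); last exact: cm.
apply: continuous_pair.
  exact/continuous_snd/continuous_fst.
exact/continuous_snd/continuous_snd.
Qed.

Definition transformation_groupoid : topGroupoid :=
  TopGroupoid tg_rng_unit tg_src_unit tg_rng_mul tg_src_mul tg_rng_inv
    tg_src_inv tg_mulA tg_mul1l tg_mul1r tg_mulV tg_mulVl tg_rng_continuous
    tg_src_continuous tg_unit_continuous tg_inv_continuous tg_mul_continuous.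

End TransformationGroupoid.

Section Restriction.
Variables (K : topGroupoid) (A : set (obj K)).

Definition restr_set : set K := (@src K @^-1` A) `&` (@rng K @^-1` A).

Definition restr_arrow : topologicalType := restr_set.

Lemma restr_srcP (a : restr_arrow) : src (val a) \in A.
Proof. by apply/mem_set; case: (set_mem (valP a)). Qed.

Lemma restr_rngP (a : restr_arrow) : rng (val a) \in A.
Proof. by apply/mem_set; case: (set_mem (valP a)). Qed.

Lemma restr_unitP (x : A) : gunit (val x) \in restr_set.
Proof.
by apply/mem_set; split; rewrite /= ?src_gunit ?rng_gunit; exact: set_mem (valP x).
Qed.

Lemma restr_invP (a : restr_arrow) : ginv (val a) \in restr_set.
Proof.
by apply/mem_set; split; rewrite /= ?src_ginv ?rng_ginv; apply: set_mem;
  [exact: restr_rngP | exact: restr_srcP].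
Qed.

Lemma restr_mulP (a b : restr_arrow) (ab : src (val a) = rng (val b)) :
  gmul ab \in restr_set.
Proof.
by apply/mem_set; split; rewrite /= ?src_gmul ?rng_gmul; apply: set_mem;
  [exact: restr_srcP | exact: restr_rngP].
Qed.

Definition restr_rng (a : restr_arrow) : A := SigSub (restr_rngP a).
Definition restr_src (a : restr_arrow) : A := SigSub (restr_srcP a).
Definition restr_unit (x : A) : restr_arrow := SigSub (restr_unitP x).
Definition restr_inv (a : restr_arrow) : restr_arrow := SigSub (restr_invP a).
Definition restr_mul (a b : restr_arrow) (ab : restr_src a = restr_rng b) :
  restr_arrow := SigSub (restr_mulP (congr1 val ab)).

Lemma restr_rng_unit x : restr_rng (restr_unit x) = x.
Proof. by apply: val_inj; rewrite /= rng_gunit. Qed.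

Lemma restr_src_unit x : restr_src (restr_unit x) = x.
Proof. by apply: val_inj; rewrite /= src_gunit. Qed.

Lemma restr_rng_mul a b (ab : restr_src a = restr_rng b) :
  restr_rng (restr_mul ab) = restr_rng a.
Proof. by apply: val_inj; rewrite /= rng_gmul. Qed.

Lemma restr_src_mul a b (ab : restr_src a = restr_rng b) :
  restr_src (restr_mul ab) = restr_src b.
Proof. by apply: val_inj; rewrite /= src_gmul. Qed.

Lemma restr_rng_inv a : restr_rng (restr_inv a) = restr_src a.
Proof. by apply: val_inj; rewrite /= rng_ginv. Qed.

Lemma restr_src_inv a : restr_src (restr_inv a) = restr_rng a.
Proof. by apply: val_inj; rewrite /= src_ginv. Qed.

Lemma restr_mulA a b c (ab : restr_src a = restr_rng b)
    (bc : restr_src b = restr_rng c)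
    (abc : restr_src (restr_mul ab) = restr_rng c)
    (abc' : restr_src a = restr_rng (restr_mul bc)) :
  restr_mul abc = restr_mul abc'.
Proof. by apply: val_inj; exact: gmulA. Qed.

Lemma restr_mul1l a (e : restr_src (restr_unit (restr_rng a)) = restr_rng a) :
  restr_mul e = a.
Proof. by apply: val_inj; exact: gmul1l. Qed.

Lemma restr_mul1r a (e : restr_src a = restr_rng (restr_unit (restr_src a))) :
  restr_mul e = a.
Proof. by apply: val_inj; exact: gmul1r. Qed.

Lemma restr_mulV a (e : restr_src a = restr_rng (restr_inv a)) :
  restr_mul e = restr_unit (restr_rng a).
Proof. by apply: val_inj; exact: gmulV. Qed.

Lemma restr_mulVl a (e : restr_src (restr_inv a) = restr_rng a) :
  restr_mul e = restr_unit (restr_src a).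
Proof. by apply: val_inj; exact: gmulVl. Qed.

Lemma restr_rng_continuous : continuous restr_rng.
Proof.
apply: continuous_set_type => a /=.
by apply: continuous_comp; [exact: val_continuous | exact: rng_continuous].
Qed.

Lemma restr_src_continuous : continuous restr_src.
Proof.
apply: continuous_set_type => a /=.
by apply: continuous_comp; [exact: val_continuous | exact: src_continuous].
Qed.

Lemma restr_unit_continuous : continuous restr_unit.
Proof.
apply: continuous_set_type => a /=.
by apply: continuous_comp; [exact: val_continuous | exact: gunit_continuous].
Qed.

Lemma restr_inv_continuous : continuous restr_inv.
Proof.
apply: continuous_set_type => a /=.
by apply: continuous_comp; [exact: val_continuous | exact: ginv_continuous].
Qed.

Lemma restr_mul_continuous :
  continuous (fun ab : [set ab : restr_arrow * restr_arrow |
      restr_src ab.1 = restr_rng ab.2] => restr_mul (set_mem (valP ab))).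
Proof.
set D := [set ab : restr_arrow * restr_arrow | _].
pose C := [set ab : K * K | src ab.1 = rng ab.2].
have P (ab : D) : (val (val ab).1, val (val ab).2) \in C.
  have e : restr_src (val ab).1 = restr_rng (val ab).2 := set_mem (valP ab).
  by apply/mem_set; exact: (congr1 val e).
pose f (ab : D) : C := SigSub (P ab).
have cf : continuous f.
  have cv := @val_continuous _ D.
  apply: continuous_set_type; apply: continuous_pair => /= ab.
    apply: (@continuous_comp _ _ _ (fun ab : D => (val ab).1)).
      exact: continuous_fst.
    exact: val_continuous.
  apply: (@continuous_comp _ _ _ (fun ab : D => (val ab).2)).
    exact: continuous_snd.
  exact: val_continuous.
apply: continuous_set_type => ab.
have := @continuous_comp _ _ _ f _ ab (cf ab) (@gmul_continuous K (f ab)).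
congr (continuous_at _ _); apply/funext => z /=; congr gmul.
exact: Prop_irrelevance.
Qed.

Definition restriction : topGroupoid :=
  TopGroupoid restr_rng_unit restr_src_unit restr_rng_mul restr_src_mul
    restr_rng_inv restr_src_inv restr_mulA restr_mul1l restr_mul1r
    restr_mulV restr_mulVl restr_rng_continuous restr_src_continuous
    restr_unit_continuous restr_inv_continuous restr_mul_continuous.

End Restriction.

Definition kakutani_equivalent (G H : groupType) (X : dynsys G) (Y : dynsys H) :=
  exists (A : set X) (B : set Y),
    [/\ clopen A, clopen B,
        \bigcup_g ((act g : X -> X) @` A) = [set: X],
        \bigcup_h ((act h : Y -> Y) @` B) = [set: Y] &
        groupoid_isomorphic
          (@restriction (transformation_groupoid X) A)
          (@restriction (transformation_groupoid Y) B)].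

Definition exist_systems (G H : groupType)
    (P : dynsys G -> dynsys H -> Prop) :=
  exists (X : dynsys G) (Y : dynsys H),
    [/\ topologically_free X, topologically_free Y & P X Y].

Definition tdsc (T : topologicalType) :=
  totally_disconnected [set: T] /\ @second_countable T.

(* Main.v *)
(** From an orbit couple (p, q) to a coarse map: q o p and p o q are local
   homeomorphisms, hence p is open, and Baire's theorem on the compact space X
   yields a point x with trivial stabiliser whose image y = p x also has
   trivial stabiliser.  Then p (g x) = phi(g) y and q (h y) = psi(h) x define
   phi and psi, whose coarse properties come from the finiteness of the ranges
   of continuous maps from compact spaces to discrete groups.  A groupoid
   isomorphism between full restrictions gives an orbit couple by first moving
   each point into the clopen set by a locally constant group element.

   Conversely, let phi be a coarse embedding and let W in G x H be the graph of
   phi restricted to a section of phi.  The nonempty subsets of G x H that look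
   like W on every finite window form a locally compact space on which G and H
   act by commuting translations, and points of such a subset with first
   (resp. second) coordinate of least rank provide locally constant
   equivariant maps to H (resp. G).  The fibres over 1 of these maps are a
   G-space X and an H-space Y, which have the same restriction to their
   intersection.  X is compact because the domain of W is coarsely dense in G,
   and Y is compact when the range of W is coarsely dense in H. *)

Require Import Defs.
From mathcomp Require Import all_boot monoid all_classical topology.

Set Implicit Arguments.
Unset Strict Implicit.
Unset Printing Implicit Defensive.

Local Open Scope classical_set_scope.
Local Open Scope group_scope.

(** * Locally constant maps and Baire's theorem *)

Lemma continuous_discreteP (X : topologicalType) (T : choiceType)
    (f : X -> discrete_topology T) :
  continuous f <-> forall x, \forall y \near x, f y = f x.
Proof.
split=> cf x; first by have := cf x; rewrite /continuous_at discrete_cvg.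
by rewrite /continuous_at discrete_cvg; exact: cf.
Qed.

Lemma finite_range (X : topologicalType) (T : choiceType)
    (f : X -> discrete_topology T) :
  compact [set: X] -> continuous f -> finite_set (range f).
Proof.
move=> /compact_near_coveringP cX /continuous_discreteP cf.
(* Sets [C] of values are taken along the finite sets they contain; the near-covering form of
   compactness then yields one finite [B] that contains every [f x]. *)
pose F : set_system (set T) :=
  filter_from (@finite_set T) (fun B => [set C | B `<=` C]).
have FF : Filter F.
  apply: filter_from_filter; first by exists set0.
  move=> A B fA fB; exists (A `|` B); first by rewrite finite_setU.
  by move=> C ABC; split=> x Bx; apply: ABC; [left|right].
have [x _|B fB BC] := cX _ F (fun C x => C (f x)) FF.
  exists ([set y | f y = f x], [set C | C (f x)]); last first.
    by case=> y C /= [-> Cfx].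
  split; first exact: cf.
  by exists [set f x] => // C; apply.
apply: sub_finite_set fB => _ [x _ <-].
by apply: (BC B).
Qed.

Lemma baire (I : Type) (X : topologicalType) (U : I -> set X) :
  countable [set: I] -> hausdorff_space X -> compact [set: X] ->
  [set: X] !=set0 -> (forall i, open (U i) /\ dense (U i)) ->
  exists x, forall i, U i x.
Proof.
move=> /countable_injP[f finj] hX cX X0 oU.
(* [V] re-indexes the family by natural numbers, with the whole space at each [n] outside the range
   of [f]. *)
pose V n := [set x | forall i, f i = n -> U i x].
have VE n : V n = setT \/ exists i, V n = U i.
  have [[i fi]|nfi] := pselect (exists i, f i = n).
    right; exists i; apply/seteqP; split=> [x|x Ux j fj]; first exact.
    suff <- : i = j by [].
    by apply: finj; rewrite ?inE // fi fj.
  by left; apply/seteqP; split=> // x _ i fi; exfalso; apply: nfi; exists i.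
have oV n : open (V n).
  by have [->|[i ->]] := VE n; [exact: openT | case: (oU i)].
have dV n : dense (V n).
  have [->|[i ->]] := VE n; last by case: (oU i).
  by move=> O O0 _; rewrite setIT.
pose good (O : set X) := open O /\ O !=set0.
(* One step of a nested sequence: regularity of the compact Hausdorff space provides the smaller
   open set, and a set that is empty or not open gets the dummy value [set0]. *)
have step (nO : nat * set X) : exists O' : set X, good nO.2 ->
    good O' /\ closure O' `<=` nO.2 `&` V nO.1.
  case: nO => n O /=.
  have [[oO O0]|nO] := pselect (good O); last by exists set0.
  have [x OVx] := dV n O O0 oO.
  have /(compact_regular hX cX) : nbhs x [set: X] by exact: filterT.
  move=> /(_ (O `&` V n)) [|B xB BO].
    by apply: open_nbhs_nbhs; split => //; exact: openI.
  exists (interior B) => _; split; first split; first exact: open_interior.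
    by exists x.
  by apply: subset_trans BO; apply: closureS; exact: interior_subset.
have {step}[s sP] := choice step.
pose O := fix O n := if n is m.+1 then s (m, O m) else [set: X].
have gO n : good (O n).
  elim: n => [|n ih]; first by split=> //; exact: openT.
  by have [] := sP (n, O n) ih.
have cO n : closure (O n.+1) `<=` O n `&` V n by have [] := sP (n, O n) (gO n).
have mO n k : O (n + k) `<=` O n.
  elim: k => [|k ih]; first by rewrite addn0.
  rewrite addnS => x Ox; apply: ih.
  by have [] := cO (n + k) x (@subset_closure _ _ _ Ox).
(* A cluster point of the sequence [O] lies in the closure of every [O n.+1], hence in every
   [V n]. *)
pose F := filter_from [set: nat] O.
have PF : ProperFilter F.
  apply: filter_from_proper; last by move=> n _; case: (gO n).
  apply: filter_from_filter; first by exists 0.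
  move=> i j _ _; exists (i + j) => // x Ox; split; first exact: mO Ox.
  by apply: (mO j i); rewrite addnC.
have [x [_ Fx]] : [set: X] `&` cluster F !=set0 by exact: cX filterT.
exists x => i.
have [//|_ ] := cO (f i) x; last exact.
by move: Fx; rewrite clusterE; apply; exists (f i).+1.
Qed.

Lemma open_neq (X Y : topologicalType) (f g : X -> Y) :
  hausdorff_space Y -> continuous f -> continuous g ->
  open [set x | f x <> g x].
Proof.
rewrite open_hausdorff => hY cf cg; rewrite openE => x /= /eqP /hY[[A B]] /=.
rewrite !inE => -[fA gB] [oA oB AB].
have fx : nbhs x (f @^-1` A) by apply: cf; exact: open_nbhs_nbhs.
have gx : nbhs x (g @^-1` B) by apply: cg; exact: open_nbhs_nbhs.
apply: filterS (filterI fx gx) => y /= [Ay By] fgy.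
have : (A `&` B) (f y) by split=> //; rewrite fgy.
by rewrite AB.
Qed.

(** * Orbit couples *)

Lemma actK (G : groupType) (X : dynsys G) (g : G) :
  cancel (act g : X -> X) (act g^-1).
Proof. by move=> x; rewrite -actM mulVg act1. Qed.

Lemma actVK (G : groupType) (X : dynsys G) (g : G) :
  cancel (act g^-1 : X -> X) (act g).
Proof. by move=> x; rewrite -actM mulgV act1. Qed.

Lemma cocycle_slice_continuous (T T' : choiceType) (X : topologicalType)
    (a : discrete_topology T * X -> discrete_topology T') (t : T) :
  continuous a -> continuous (fun x => a (t, x)).
Proof.
move=> ca x; apply: (@continuous_comp _ _ _
    (fun x => (t : discrete_topology T, x)) a); last exact: ca.
apply: continuous_pair => z; last exact: cvg_id.
exact: (@cst_continuous _ (discrete_topology T)).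
Qed.

(** The guard makes the set the whole space at [g = 1], so that Baire's theorem applies to the
    family indexed by all of [G]. *)
Lemma open_dense_free (G : groupType) (X : dynsys G) (g : G) :
  topologically_free X ->
  open [set x : X | g <> 1 -> act g x <> x] /\
  dense [set x : X | g <> 1 -> act g x <> x].
Proof.
move=> fX; have [->|/eqP g1] := eqVneq g 1.
  rewrite (_ : [set x | _] = [set: X]); last first.
    by apply/seteqP; split=> // x _ [].
  by split; [exact: openT | move=> ? ? _; rewrite setIT].
have -> : [set x : X | g <> 1 -> act g x <> x] = [set x | act g x <> x].
  by apply/seteqP; split=> x /=; [exact|move=> ? _].
split; last exact: fX.
apply: (@open_neq X X (act g) id); first exact: phase_hausdorff.
  exact: act_continuous.
by move=> x; exact: cvg_id.
Qed.

Section OrbitCouple.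
Variables (G H : groupType) (X : dynsys G) (Y : dynsys H).
Variables (p : X -> Y) (q : Y -> X).
Hypothesis pq : orbit_couple p q.

(* Near p x, y |-> p (g(x)^-1 q(y)) is multiplication by a constant c fixing
   p x; precomposing with c^-1 gives a local section of p. *)
Lemma orbit_couple_open (U : set X) x :
  open U -> U x -> nbhs (p x) (p @` U).
Proof.
case: pq => -[cp [a [ca pa]]] [cq _] [g [_ gE]] [h [ch hE]] oU Ux.
pose f y := act (g x : G)^-1 (q y).
have fE : f (p x) = x by rewrite /f gE actK.
have cf : continuous f.
  by move=> y; apply: continuous_comp; [exact: cq | exact: act_continuous].
pose c y : H := (a ((g x : G)^-1, q y) : H) * (h y : H).
have cE y : p (f y) = act (c y) y by rewrite /f pa hE actM.
have cc : \forall y \near p x, c y = c (p x).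
  have ca' : continuous
      (fun y => a ((g x : G)^-1, q y) : discrete_topology H).
    move=> y; apply: (@continuous_comp _ _ _ q
      (fun z => a ((g x : G)^-1, z))); first exact: cq.
    exact: cocycle_slice_continuous.
  move/continuous_discreteP: ch => /(_ (p x)) ch.
  move/continuous_discreteP: ca' => /(_ (p x)) ca'.
  by apply: filterS (filterI ch ca') => y [hy ay]; rewrite /c hy ay.
have cpx : act (c (p x)) (p x) = p x by rewrite -cE fE.
have cpxV : act (c (p x))^-1 (p x) = p x by rewrite -{2}cpx actK.
have cV : {for p x, continuous (act (c (p x))^-1 : Y -> Y)}.
  exact: act_continuous.
have cfx : nbhs (p x) (f @^-1` U).
  by apply: cf; rewrite fE; exact: open_nbhs_nbhs.
have : nbhs (p x) (act (c (p x))^-1 @^-1`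
    (f @^-1` U `&` [set y | c y = c (p x)])).
  by apply: cV; rewrite cpxV; exact: filterI.
apply: filterS => y /= [fU cy]; exists (f (act (c (p x))^-1 y)) => //.
by rewrite cE cy actVK.
Qed.

(** As [p] is open, the image of a nonempty open set has nonempty interior, which [D] meets. *)
Lemma orbit_couple_dense (D : set Y) : dense D -> dense (p @^-1` D).
Proof.
move=> dD U [x Ux] oU.
have [|y [/nbhs_singleton/= [z Uz <-] Dz]] :=
    dD (interior (p @` U)) _ (open_interior _); last by exists z.
by exists (p x); exact: orbit_couple_open.
Qed.

Lemma orbit_couple_free_point :
  countable [set: G] -> countable [set: H] -> compact [set: X] ->
  topologically_free X -> topologically_free Y ->
  exists x, (forall g, act g x = x -> g = 1) /\
            (forall h, act h (p x) = p x -> h = 1).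
Proof.
move=> cG cH cX fX fY.
have cp : continuous p by case: pq => -[].
(* One dense open set for each pair: the points moved by [gh.1] whose images are moved by [gh.2], an
   identity component imposing nothing. *)
have [||||gh|x xP] := @baire (G * H) X (fun gh =>
  [set x | gh.1 <> 1 -> act gh.1 x <> x] `&`
  (p @^-1` [set y | gh.2 <> 1 -> act gh.2 y <> y])).
- by rewrite -setXTT; exact: countableX.
- exact: phase_hausdorff.
- by [].
- exact: phase_nonempty.
- have [oA dA] := open_dense_free gh.1 fX.
  have [oB dB] := open_dense_free gh.2 fY.
  split; first by apply: openI => //; apply: open_comp => // x _; exact: cp.
  by apply: denseI => //; exact: orbit_couple_dense.
- exists x; split=> k kx; apply: contrapT => k1.
    by case: (xP (k, 1)) => + _; apply.
  by case: (xP (1, k)) => _; apply.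
Qed.

End OrbitCouple.

(** The common form of the coarse estimates below: [u] is the identity for [phi] and [psi], while
    [u = phi] with [v] the identity gives the converse half of a coarse embedding. *)
Lemma finite_controlled (G H : groupType) (I : Type) (u : I -> G) (v : I -> H)
    (F : G -> set H) (S : set (I * I)) :
  (forall g, finite_set (F g)) ->
  (forall s t, F (u s * (u t)^-1) (v s * (v t)^-1)) ->
  finite_set [set u st.1 * (u st.2)^-1 | st in S] ->
  finite_set [set v st.1 * (v st.2)^-1 | st in S].
Proof.
move=> fF Fuv fu; apply: sub_finite_set (bigcup_finite fu (fun g _ => fF g)).
move=> _ [[s t] Sst <-]; exists (u s * (u t)^-1); last exact: Fuv.
by exists (s, t).
Qed.

Lemma orbit_couple_coarse (G H : groupType) (X : dynsys G) (Y : dynsys H)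
    (p : X -> Y) (q : Y -> X) :
  countable [set: G] -> countable [set: H] -> compact [set: X] ->
  topologically_free X -> topologically_free Y -> orbit_couple p q ->
  exists phi : G -> H, [/\ coarse_embedding phi,
    compact [set: Y] -> coarse_equivalence phi &
    cancel p q -> cancel q p -> bijective phi].
Proof.
move=> cG cH cX fX fY pq.
have [x0 [freeX freeY]] := orbit_couple_free_point pq cG cH cX fX fY.
case: pq => -[cp [a [ca pa]]] [cq [b [cb qb]]] [g [cg gE]] [h [ch hE]].
pose y0 := p x0.
have injX s t : act s x0 = act t x0 -> s = t.
  move=> e; apply: (mulgI t^-1); rewrite mulVg; apply: freeX.
  by rewrite actM e actK.
have injY s t : act s y0 = act t y0 -> s = t.
  move=> e; apply: (mulgI t^-1); rewrite mulVg; apply: freeY.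
  by rewrite actM e actK.
pose phi (s : G) : H := a (s, x0).
(* The factor [g x0] compares [q y0] with [x0], since [q (p x0) = act (g x0) x0]. *)
pose psi (t : H) : G := (b (t, y0) : G) * (g x0 : G).
have phiE s : p (act s x0) = act (phi s) y0 by rewrite pa.
have psiE t : q (act t y0) = act (psi t) x0 by rewrite qb gE actM.
(* The cocycle identity for [a], read off at [y0], where the stabiliser is trivial. *)
have phiM s t : phi s * (phi t)^-1 = a (s * t^-1, act t x0).
  apply: (@mulIg _ (phi t)); rewrite mulgVK; apply: injY.
  by rewrite -phiE actM -phiE -pa -actM mulgVK.
have psiM s t : psi s * (psi t)^-1 = b (s * t^-1, act t y0).
  apply: (@mulIg _ (psi t)); rewrite mulgVK; apply: injX.
  by rewrite -psiE actM -psiE -qb -actM mulgVK.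
have psi_phi s : psi (phi s) = (g (act s x0) : G) * s.
  by apply: injX; rewrite -psiE -phiE gE actM.
have phi_psi t : phi (psi t) = (h (act t y0) : H) * t.
  by apply: injY; rewrite -phiE -psiE hE actM.
have fina s : finite_set (range (fun x => a (s, x))).
  by apply: finite_range => //; exact: cocycle_slice_continuous.
have fing : finite_set (range (g : X -> G)) by exact: finite_range.
(* Only [X] is known to be compact at this point, so finiteness of the values of [b] is secured
   along the image of [p]. *)
have finbp t : finite_set (range (fun x => b (t, p x))).
  apply: (@finite_range X G) => // x.
  apply: (@continuous_comp _ _ _ p (fun y => b (t, y))); first exact: cp.
  exact: cocycle_slice_continuous.
have phi_ctrl (S : set (G * G)) :
    finite_set [set st.1 * st.2^-1 | st in S] ->
    finite_set [set phi st.1 * (phi st.2)^-1 | st in S].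
  move=> fS; apply: (@finite_controlled G H G id phi
    (fun s => range (fun x => a (s, x) : H)) S fina _ fS) => s t.
  by exists (act t x0) => //; rewrite phiM.
exists phi; split.
- move=> S; split; first exact: phi_ctrl.
  (* By [psi_phi], [s t^-1] is the product of [g(s x0)^-1], of [psi(phi s) psi(phi t)^-1] and of
     [g(t x0)]; [F] collects the possible values of such products. *)
  pose F t : set G :=
    [set uv.1^-1 * uv.2 | uv in range g `*`
      [set vw.1 * vw.2 | vw in range (fun x => b (t, p x)) `*` range g]].
  have finF t : finite_set (F t).
    by apply: finite_image; apply: finite_setX => //; apply: finite_image;
       exact: finite_setX.
  move=> fS; apply: (@finite_controlled H G G phi id F S finF _ fS) => s t /=.
  have e : s * t^-1 = (g (act s x0) : G)^-1 *
      ((psi (phi s) * (psi (phi t))^-1) * (g (act t x0) : G)).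
    by rewrite !psi_phi invgM !mulgA mulVg mul1g mulgVK.
  rewrite e psiM; exists (g (act s x0),
    (b (phi s * (phi t)^-1, act (phi t) y0) : G) * (g (act t x0) : G)) => //.
  split; first by exists (act s x0).
  exists (b (phi s * (phi t)^-1, act (phi t) y0) : G, g (act t x0) : G) => //.
  split; last by exists (act t x0).
  by exists (act t x0) => //; rewrite phiE.
- move=> cY.
  have finb t : finite_set (range (fun y => b (t, y))).
    by apply: finite_range => //; exact: cocycle_slice_continuous.
  have finh : finite_set (range (h : Y -> H)) by exact: finite_range.
  split; first split=> //.
    (* On the fibre over [y] one has [s = g(s x0)^-1 psi(y)], and [g] has finite range. *)
    move=> y; apply: sub_finite_set (finite_image (fun k => k^-1 * psi y) fing).
    by move=> s <-; exists (g (act s x0)) => //; rewrite psi_phi mulKg.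
  exists psi; split; first split.
  + move=> x; apply: sub_finite_set (finite_image (fun k => k^-1 * phi x) finh).
    by move=> t <-; exists (h (act t y0)) => //; rewrite phi_psi mulKg.
  + move=> S fS; apply: (@finite_controlled H G H id psi
      (fun t => range (fun y => b (t, y) : G)) S finb _ fS) => s t.
    by exists (act t y0) => //; rewrite psiM.
  + apply: sub_finite_set fing => _ [s _ <-] /=.
    by rewrite psi_phi mulgK; exists (act s x0).
  + apply: sub_finite_set finh => _ [t _ <-] /=.
    by rewrite phi_psi mulgK; exists (act t y0).
- move=> pK qK; exists psi => s.
    by apply: injX; rewrite -psiE -phiE pK.
  by apply: injY; rewrite -phiE -psiE qK.
Qed.

(** * Kakutani equivalence *)

Lemma near_finite (T I : Type) (F : set_system T) (D : set I)
    (P : I -> T -> Prop) : Filter F -> finite_set D ->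
  (forall i, D i -> \forall x \near F, P i x) ->
  \forall x \near F, forall i, D i -> P i x.
Proof.
move=> FF /finite_setP[n]; elim: n D => [|n ih] D.
  rewrite II0 card_eq0 => /eqP -> _.
  by apply: filterE.
move=> /eq_cardSP[i Di /ih{}ih] PF.
have PD : \forall x \near F, forall j, (D `\ i) j -> P j x.
  by apply: ih => j [Dj _]; exact: PF.
apply: filterS (filterI (PF i Di) PD) => x [Pi Px] j Dj.
by have [->//|ji] := pselect (j = i); exact: Px.
Qed.

Lemma finite_rank_lt (I : Type) (rk : I -> nat) (n : nat) :
  injective rk -> finite_set [set i | (rk i < n)%N].
Proof.
move=> rki; apply: (@finite_preimage _ _ `I_n rk); last exact: finite_II.
by move=> i j _ _; exact: rki.
Qed.

(** Choosing the index of least rank is locally constant: near [x] the set [P (s x)] persists, and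
    the sets of lower rank that meet it are finitely many closed sets missing [x], so a
    neighbourhood of [x] avoids them all. *)
Lemma clopen_selection (I : choiceType) (X : topologicalType) (rk : I -> nat)
    (P : I -> set X) :
  (forall i, clopen (P i)) -> (forall x, exists i, P i x) ->
  (forall x i j, P i x -> P j x -> rk i = rk j -> i = j) ->
  (forall i, finite_set [set j | (rk j < rk i)%N /\ P i `&` P j !=set0]) ->
  exists s : X -> discrete_topology I, continuous s /\
    forall x, P (s x) x /\ forall i, P i x -> (rk (s x) <= rk i)%N.
Proof.
move=> cP PX Puniq Pfin.
have PX' x : exists i, P i x /\ forall j, P j x -> (rk i <= rk j)%N.
  have ex : exists n, `[< exists2 i, P i x & rk i = n >].
    by have [i Pi] := PX x; exists (rk i); apply/asboolP; exists i.
  case: (ex_minnP ex) => n /asboolP[i Pi <-] mini.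
  by exists i; split=> // j Pj; apply: mini; apply/asboolP; exists j.
have [s sP] := choice PX'; exists s; split=> //.
apply/continuous_discreteP => x; have [Px minx] := sP x.
have nP := near_finite (F := nbhs x) (P := fun i y => ~ P i y) _ (Pfin (s x)).
have Ps : \forall y \near x, P (s x) y.
  by apply: open_nbhs_nbhs; split=> //; case: (cP (s x)).
apply: filterS (filterI (nP _ _) Ps) => [y [nPy Psy]|i [ix _]].
  have [Py miny] := sP y.
  apply: (Puniq y) => //; apply/eqP; rewrite eqn_leq miny //= leqNgt.
  by apply/negP => yx; apply: (nPy (s y)) => //; split=> //; exists y.
apply: open_nbhs_nbhs; split; first by apply: closed_openC; case: (cP i).
by move=> /minx; rewrite leqNgt ix.
Qed.

Lemma continuous_discrete_prod (X Z : topologicalType) (T : choiceType)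
    (f : discrete_topology T * X -> Z) :
  (forall t : T, continuous (fun x => f (t, x))) -> continuous f.
Proof.
move=> cf [t x] U /= fU.
exists ([set t], (fun y => f (t, y)) @^-1` U).
  by split=> /=; [exact: discrete_set1 | exact: cf].
by move=> [s y] /= [-> fy].
Qed.

Lemma continuous_act (G : groupType) (X : dynsys G) (Z : topologicalType)
    (g : Z -> discrete_topology G) (u : Z -> X) :
  continuous g -> continuous u -> continuous (fun z => act (g z) (u z)).
Proof.
move=> cg cu z; apply: (@continuous_comp _ _ _ (fun z => (g z, u z))
  (fun gx : discrete_topology G * X => act gx.1 gx.2)).
  exact: continuous_pair.
by apply: continuous_discrete_prod => t; exact: act_continuous.
Qed.

Lemma continuous_discrete2 (T1 T2 T : choiceType) (Z : topologicalType)
    (m : T1 -> T2 -> T) (f : Z -> discrete_topology T1)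
    (g : Z -> discrete_topology T2) :
  continuous f -> continuous g ->
  continuous (fun z => m (f z) (g z) : discrete_topology T).
Proof.
move=> /continuous_discreteP cf /continuous_discreteP cg.
apply/continuous_discreteP => z.
by apply: filterS (filterI (cf z) (cg z)) => y [-> ->].
Qed.

Definition restricted_groupoid (G : groupType) (X : dynsys G) (A : set X) :=
  @restriction (transformation_groupoid X) A.

(** The arrow [(u z, g z)] goes from [v z] to [u z], and [eta z] is the [H]-label of its image under
    [phi]. *)
Lemma functor_cocycle (G H : groupType) (X : dynsys G) (Y : dynsys H)
    (A : set X) (B : set Y)
    (phi : restricted_groupoid A -> restricted_groupoid B) (phi0 : A -> B)
    (Z : topologicalType) (u v : Z -> A) (g : Z -> discrete_topology G) :
  continuous phi ->
  (forall a, restr_rng (phi a) = phi0 (restr_rng a)) ->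
  (forall a, restr_src (phi a) = phi0 (restr_src a)) ->
  continuous u -> continuous g ->
  (forall z, val (u z) = act (g z) (val (v z))) ->
  exists eta : Z -> discrete_topology H, continuous eta /\
    forall z, val (phi0 (u z)) = act (eta z) (val (phi0 (v z))).
Proof.
move=> cphi phir phis cu cg uv.
have arP z : (val (u z), g z) \in @restr_set (transformation_groupoid X) A.
  apply/mem_set; split; last exact: set_valP.
  by rewrite /= /tg_src /= uv actK; exact: set_valP.
pose ar z : restricted_groupoid A := SigSub (arP z).
have car : continuous ar.
  apply: continuous_set_type; apply: continuous_pair => //.
  by move=> z; apply: continuous_comp; [exact: cu | exact: val_continuous].
exists (fun z => (val (phi (ar z))).2); split.
  apply: continuous_snd => z.
  apply: continuous_comp; last exact: val_continuous.
  by apply: continuous_comp; [exact: car | exact: cphi].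
move=> z.
have -> : u z = restr_rng (ar z) by exact: val_inj.
have -> : v z = restr_src (ar z).
  by apply: val_inj; rewrite /= /tg_src /= uv actK.
by rewrite -phir -phis /= /tg_src actVK.
Qed.

Lemma functor_orbit_map (G H : groupType) (X : dynsys G) (Y : dynsys H)
    (A : set X) (B : set Y)
    (phi : restricted_groupoid A -> restricted_groupoid B) (phi0 : A -> B)
    (gamma : X -> discrete_topology G) (e : X -> A) :
  continuous phi -> continuous phi0 ->
  (forall a, restr_rng (phi a) = phi0 (restr_rng a)) ->
  (forall a, restr_src (phi a) = phi0 (restr_src a)) ->
  continuous gamma -> continuous e ->
  (forall x, val (e x) = act (gamma x) x) ->
  continuous_orbit_map (fun x => val (phi0 (e x))).
Proof.
move=> cphi cphi0 phir phis cg ce eE; split.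
  move=> x; apply: continuous_comp; last exact: val_continuous.
  by apply: continuous_comp; [exact: ce | exact: cphi0].
pose Z : topologicalType := (discrete_topology G * X)%type.
have cact : continuous (fun z : Z => act z.1 z.2 : X).
  by apply: continuous_discrete_prod => t; exact: act_continuous.
have cfst : continuous (fst : Z -> discrete_topology G).
  by move=> z; exact: cvg_fst.
have csnd : continuous (snd : Z -> X) by move=> z; exact: cvg_snd.
have cgact : continuous (fun z : Z => gamma (act z.1 z.2)).
  by move=> z; apply: continuous_comp; [exact: cact | exact: cg].
have cgsnd : continuous (fun z : Z => gamma z.2).
  by move=> z; apply: continuous_comp; [exact: csnd | exact: cg].
(* The point [e (g x)] is obtained from [e x] by applying [gamma(g x) g gamma(x)^-1]; the functor
   turns this label into one in [H]. *)
have [||z|a [ca aE]] := functor_cocycle (Z := Z) (u := fun z => e (act z.1 z.2))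
  (v := fun z => e z.2)
  (g := fun z => (gamma (act z.1 z.2) : G) * (z.1 : G) * (gamma z.2 : G)^-1)
  cphi phir phis.
- by move=> z; apply: continuous_comp; [exact: cact | exact: ce].
- have c1 := @continuous_discrete2 G G G Z (fun x y => x * y) _ _ cgact cfst.
  exact: (@continuous_discrete2 G G G Z (fun x y => x * y^-1) _ _ c1 cgsnd).
- by rewrite !eE -[RHS]actM mulgVK actM.
by exists a; split=> // g x; rewrite (aE (g, x)).
Qed.

(** The arrow that moves [phi0 (e x)] into [B] by [delta] is sent by [psi] to an arrow starting at
    [psi0 (phi0 (e x)) = e x]. Its label times [gamma x] is [g x]. *)
Lemma functor_retract (G H : groupType) (X : dynsys G) (Y : dynsys H)
    (A : set X) (B : set Y)
    (phi0 : A -> B) (psi : restricted_groupoid B -> restricted_groupoid A)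
    (psi0 : B -> A) (gamma : X -> discrete_topology G)
    (delta : Y -> discrete_topology H) (e : X -> A) (f : Y -> B) :
  continuous psi -> continuous phi0 -> cancel phi0 psi0 ->
  (forall b, restr_rng (psi b) = psi0 (restr_rng b)) ->
  (forall b, restr_src (psi b) = psi0 (restr_src b)) ->
  continuous gamma -> continuous delta -> continuous e -> continuous f ->
  (forall x, val (e x) = act (gamma x) x) ->
  (forall y, val (f y) = act (delta y) y) ->
  exists g : X -> discrete_topology G, continuous g /\
    forall x, val (psi0 (f (val (phi0 (e x))))) = act (g x) x.
Proof.
move=> cpsi cphi0 phi0K psir psis cg cd ce cf eE fE.
have cp : continuous (fun x => val (phi0 (e x)) : Y).
  move=> x; apply: continuous_comp; last exact: val_continuous.
  by apply: continuous_comp; [exact: ce | exact: cphi0].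
have [||x|g [cg' gE]] := functor_cocycle (u := fun x => f (val (phi0 (e x))))
  (v := fun x => phi0 (e x)) (g := fun x => delta (val (phi0 (e x))))
  cpsi psir psis.
- by move=> x; apply: continuous_comp; [exact: cp | exact: cf].
- by move=> x; apply: continuous_comp; [exact: cp | exact: cd].
- exact: fE.
exists (fun x => (g x : G) * (gamma x : G)); split.
  exact: (@continuous_discrete2 G G G X (fun x y => x * y)).
by move=> x; rewrite gE phi0K eE actM.
Qed.

(** The last clause treats the case where no point has to be moved; it makes the couple an orbit
    equivalence. *)
Lemma kakutani_couple (G H : groupType) (X : dynsys G) (Y : dynsys H)
    (A : set X) (B : set Y)
    (gamma : X -> discrete_topology G) (delta : Y -> discrete_topology H) :
  groupoid_isomorphic (restricted_groupoid A) (restricted_groupoid B) ->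
  continuous gamma -> (forall x, A (act (gamma x) x)) ->
  continuous delta -> (forall y, B (act (delta y) y)) ->
  exists (p : X -> Y) (q : Y -> X), orbit_couple p q /\
    ((forall x, gamma x = 1 :> G) -> (forall y, delta y = 1 :> H) ->
     cancel p q /\ cancel q p).
Proof.
move=> [phi [phi0 []]] [cphi [psi [cpsi phiK psiK]]].
move=> [cphi0 [psi0 [cpsi0 phi0K psi0K]]] phir phis _ cg gA cd dB.
have {}phir (a : restricted_groupoid A) :
  restr_rng (phi a) = phi0 (restr_rng a) := phir a.
have {}phis (a : restricted_groupoid A) :
  restr_src (phi a) = phi0 (restr_src a) := phis a.
have psir b : restr_rng (psi b) = psi0 (restr_rng b).
  by rewrite -[b in RHS]psiK phir phi0K.
have psis b : restr_src (psi b) = psi0 (restr_src b).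
  by rewrite -[b in RHS]psiK phis phi0K.
pose e x : A := SigSub (mem_set (gA x)).
pose f y : B := SigSub (mem_set (dB y)).
have ce : continuous e.
  by apply: continuous_set_type; apply: continuous_act => // x; exact: cvg_id.
have cf : continuous f.
  by apply: continuous_set_type; apply: continuous_act => // x; exact: cvg_id.
have eE x : val (e x) = act (gamma x) x by [].
have fE y : val (f y) = act (delta y) y by [].
exists (fun x => val (phi0 (e x))), (fun y => val (psi0 (f y))); split.
  split.
  - exact: functor_orbit_map cphi cphi0 phir phis cg ce eE.
  - exact: functor_orbit_map cpsi cpsi0 psir psis cd cf fE.
  - exact: functor_retract cpsi cphi0 phi0K psir psis cg cd ce cf eE fE.
  - exact: functor_retract cphi cpsi0 psi0K phir phis cd cg cf ce fE eE.
move=> g1 d1; split=> [x|y].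
  rewrite (_ : f _ = phi0 (e x)) ?phi0K ?eE ?g1 ?act1 //.
  by apply: val_inj; rewrite fE d1 act1.
rewrite (_ : e _ = psi0 (f y)) ?psi0K ?fE ?d1 ?act1 //.
by apply: val_inj; rewrite eE g1 act1.
Qed.

(** [gamma x] is the element of least rank that moves [x] into [A]; as the rank is injective, only
    finitely many elements precede a given one. *)
Lemma full_clopen_hitting (G : groupType) (X : dynsys G) (A : set X) :
  countable [set: G] -> clopen A ->
  \bigcup_g ((act g : X -> X) @` A) = [set: X] ->
  exists gamma : X -> discrete_topology G,
    continuous gamma /\ forall x, A (act (gamma x) x).
Proof.
move=> /countable_injP[rk rki] cA fullA.
have {}rki : injective rk by move=> g h; apply: rki; rewrite inE.
have [|x|x g h _ _|g|s [cs sP]] :=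
  @clopen_selection G X rk (fun g => act g @^-1` A).
- by move=> g; apply: preimage_clopen; [|exact: act_continuous].
- have [g _ [a Aa <-]] : (\bigcup_g (act g @` A)) x by rewrite fullA.
  by exists g^-1; rewrite /= actK.
- exact: rki.
- by apply: sub_finite_set (finite_rank_lt (rk g) rki) => h [].
- by exists s; split=> // x; case: (sP x).
Qed.

Lemma kakutani_has_orbit_couple (G H : groupType)
    (X : dynsys G) (Y : dynsys H) :
  countable [set: G] -> countable [set: H] ->
  kakutani_equivalent X Y -> has_orbit_couple X Y.
Proof.
move=> cG cH [A [B [cA cB fullA fullB iso]]].
have [gamma [cg gA]] := full_clopen_hitting cG cA fullA.
have [delta [cd dB]] := full_clopen_hitting cH cB fullB.
have [p [q [pq _]]] := kakutani_couple iso cg gA cd dB.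
by exists p, q.
Qed.

(** * Couplings *)

Section SetType.
Variables (T : topologicalType) (A : set T).
Let v : A -> T := val.

Lemma hausdorff_set_type : hausdorff_space T -> hausdorff_space A.
Proof.
rewrite !open_hausdorff => hT x y xy.
have [|[U V] /= [xU yV] [oU oV UV]] := hT (val x) (val y).
  by apply: contra_neq xy; exact: val_inj.
exists (v @^-1` U, v @^-1` V); first by rewrite !inE /= in xU yV *.
split; [by exists U | by exists V |].
by rewrite -preimage_setI (eqP UV) preimage_set0.
Qed.

Lemma zero_dimensional_set_type : zero_dimensional T -> zero_dimensional A.
Proof.
move=> zT x y xy; have [|U [cU Ux nUy]] := zT (val x) (val y).
  by apply: contra_neq xy; exact: val_inj.
exists (v @^-1` U); split=> //.
by apply: preimage_clopen => //; exact: val_continuous.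
Qed.

Lemma second_countable_set_type : @second_countable T -> @second_countable A.
Proof.
move=> [B cB [oB bB]]; exists [set v @^-1` U | U in B].
  by apply: sub_countable cB; exact: card_image_le.
split=> [_ [U BU <-]|x]; first by exists U => //; exact: oB.
move=> W [_ [[U oU <-] Ux UW]].
have [V [BV Vx] VU] : filter_from [set V | B V /\ V (v x)] id U.
  by apply: bB; exact: open_nbhs_nbhs.
exists (v @^-1` V); first by split=> //; exists V.
by move=> y Vy; apply: UW; exact: VU.
Qed.

Lemma compact_set_type (K : set T) :
  compact (A `&` K) -> compact (v @^-1` K).
Proof.
move=> cAK F PF FK.
have [|p [[Ap Kp] Fp]] := cAK (v @ F) _.
  rewrite /fmap /=; apply: filterS FK => x Kx.
  by split=> //; exact: set_valP.
exists (SigSub (mem_set Ap)); split=> // S W FS [_ [[U oU <-] Up UW]].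
have FvS : (v @ F) (v @` S).
  by rewrite /fmap /=; apply: filterS FS => x Sx; exists x.
have [_ [[x Sx <-] Ux]] := Fp _ U FvS (open_nbhs_nbhs (conj oU Up)).
by exists x; split=> //; exact: UW.
Qed.

Lemma locally_compact_set_type :
  closed A -> locally_compact [set: T] -> locally_compact [set: A].
Proof.
move=> cA lT x _; have [U xU [cU kU]] := lT (v x) I.
have {}xU : nbhs (v x) U.
  by move: xU; rewrite within_interior //; exact: filterT.
exists (v @^-1` U).
  rewrite within_interior; last exact: filterT.
  exact: (@val_continuous _ A x U xU).
have cAU : compact (A `&` U) by rewrite setIC; exact: compact_closedI.
split; first exact: compact_set_type cAU.
by have /continuous_closedP := @val_continuous _ A; apply.
Qed.

End SetType.

(* rcoord and lcoord play the role of fundamental domains: the fibre of rcoord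
   (resp. lcoord) over 1 meets each orbit of H (resp. G) exactly once. *)
Record coupling (G H : groupType) := Coupling {
  coupling_space :> topologicalType;
  lact : G -> coupling_space -> coupling_space;
  ract : H -> coupling_space -> coupling_space;
  lcoord : coupling_space -> discrete_topology G;
  rcoord : coupling_space -> discrete_topology H;
  coupling_nonempty : [set: coupling_space] !=set0;
  coupling_hausdorff : hausdorff_space coupling_space;
  coupling_locally_compact : locally_compact [set: coupling_space];
  lact1 : forall w, lact 1 w = w;
  ract1 : forall w, ract 1 w = w;
  lactM : forall g g' w, lact (g * g') w = lact g (lact g' w);
  ractM : forall h h' w, ract (h * h') w = ract h (ract h' w);
  lract : forall g h w, lact g (ract h w) = ract h (lact g w);
  lact_continuous : forall g, continuous (lact g);
  ract_continuous : forall h, continuous (ract h);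
  lcoord_continuous : continuous lcoord;
  rcoord_continuous : continuous rcoord;
  lcoord_lact : forall g w, lcoord (lact g w) = g * (lcoord w : G) :> G;
  rcoord_ract : forall h w, rcoord (ract h w) = h * (rcoord w : H) :> H
}.

(** By this symmetry each statement on the fibre of [rcoord] also gives the one on the fibre of
    [lcoord]. *)
Definition coupling_swap (G H : groupType) (C : coupling G H) : coupling H G :=
  Coupling (coupling_nonempty C) (@coupling_hausdorff _ _ C)
    (@coupling_locally_compact _ _ C) (@ract1 _ _ C) (@lact1 _ _ C)
    (@ractM _ _ C) (@lactM _ _ C) (fun h g w => esym (lract g h w))
    (@ract_continuous _ _ C) (@lact_continuous _ _ C)
    (@rcoord_continuous _ _ C) (@lcoord_continuous _ _ C)
    (@rcoord_ract _ _ C) (@lcoord_lact _ _ C).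

(** * Slices of a coupling as dynamical systems *)

Section Slice.
Variables (G H : groupType) (C : coupling G H).

Definition slice : set C := [set w | rcoord w = 1 :> H].

(** The unique point of the [H]-orbit of [w] that lies in the slice. *)
Definition to_slice (w : C) : C := ract (rcoord w : H)^-1 w.

Lemma to_sliceP w : to_slice w \in slice.
Proof. by apply/mem_set; rewrite /slice /= rcoord_ract mulVg. Qed.

Lemma to_slice_id w : slice w -> to_slice w = w.
Proof. by rewrite /to_slice => ->; rewrite invg1 ract1. Qed.

Lemma to_slice_ract h w : to_slice (ract h w) = to_slice w.
Proof.
by rewrite /to_slice rcoord_ract invgM ractM -(ractM h^-1) mulVg ract1.
Qed.

Lemma clopen_slice : clopen slice.
Proof.
rewrite (_ : slice = @rcoord G H C @^-1` [set (1 : H)]) //.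
apply: preimage_clopen; last exact: rcoord_continuous.
by split; [exact: discrete_open | exact: discrete_closed].
Qed.

Lemma to_slice_continuous : continuous to_slice.
Proof.
move=> w; apply: (@continuous_comp _ _ _ (fun w => (rcoord w, w))
  (fun hw : discrete_topology H * C => ract (hw.1 : H)^-1 hw.2)).
  by apply: continuous_pair => x; [exact: rcoord_continuous | exact: cvg_id].
apply: continuous_discrete_prod => t.
exact: (@ract_continuous _ _ C (t : H)^-1).
Qed.

(** The slice is a copy of the space of [H]-orbits, on which [G] acts because the two actions
    commute. *)
Definition slice_act (g : G) (x : slice) : slice :=
  SigSub (to_sliceP (lact g (val x))).

Lemma slice_act1 x : slice_act 1 x = x.
Proof. by apply: val_inj; rewrite /= lact1 to_slice_id //; exact: set_valP. Qed.

Lemma slice_actM g g' x : slice_act (g * g') x = slice_act g (slice_act g' x).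
Proof. by apply: val_inj; rewrite /= lactM lract to_slice_ract. Qed.

Lemma slice_act_continuous g : continuous (slice_act g).
Proof.
apply: continuous_set_type => x.
apply: (@continuous_comp _ _ _ (fun x : slice => lact g (val x)) to_slice).
  by apply: continuous_comp; [exact: val_continuous | exact: lact_continuous].
exact: to_slice_continuous.
Qed.

Lemma slice_act_homeo g : homeomorphism (slice_act g).
Proof.
split; first exact: slice_act_continuous.
exists (slice_act g^-1); split=> [|x|x]; first exact: slice_act_continuous.
  by rewrite -slice_actM mulVg slice_act1.
by rewrite -slice_actM mulgV slice_act1.
Qed.

Lemma slice_nonempty : [set: slice] !=set0.
Proof.
by have [w _] := coupling_nonempty C; exists (SigSub (to_sliceP w)).
Qed.

Definition slice_system : dynsys G :=
  DynSys slice_nonempty (hausdorff_set_type (@coupling_hausdorff _ _ C))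
    (locally_compact_set_type (proj2 clopen_slice)
       (@coupling_locally_compact _ _ C))
    slice_act1 slice_actM slice_act_homeo.

(** If [g] fixes [x] in the slice, then [lact g x = ract h x] for [h = rcoord (lact g x)]. As [h] is
    locally constant, density for the single pair [(g, h^-1)] suffices near each point. *)
Lemma slice_topologically_free :
  (forall g h, g <> 1 -> dense [set w : C | lact g (ract h w) <> w]) ->
  topologically_free slice_system.
Proof.
move=> free g g1 U [x Ux] oU.
case: (oU) => V oV UE.
pose h (w : C) : discrete_topology H := (rcoord (lact g w)).
have ch : continuous h.
  move=> w; apply: continuous_comp; first exact: lact_continuous.
  exact: rcoord_continuous.
pose W := V `&` slice `&` h @^-1` [set h (val x)].
have [||w [[[Vw sw] hw] gw]] := free g (h (val x) : H)^-1 g1 W.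
- exists (val x); split=> //; split; last exact: set_valP.
  by have : ((val : slice -> C) @^-1` V) x by rewrite UE.
- apply: openI; first by apply: openI => //; case: clopen_slice.
  by apply: open_comp; [move=> ? _; exact: ch | exact: discrete_open].
exists (SigSub (mem_set sw)); split; first by rewrite -UE.
move=> /(congr1 val) /=; rewrite /to_slice -[rcoord _]/(h w) hw.
by rewrite -lract.
Qed.

End Slice.

Arguments slice {G H} C _.

(* The intersection of the slices of C and of coupling_swap C, seen inside the
   slice of C. *)
Definition base_slice (G H : groupType) (C : coupling G H) :
    set (slice_system C) :=
  [set x | lcoord (val (x : slice C)) = 1 :> G].
Arguments base_slice {G H} C _.

Lemma clopen_base_slice (G H : groupType) (C : coupling G H) :
  clopen (base_slice C).
Proof.
rewrite (_ : base_slice C =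
    (fun x : slice C => lcoord (val x)) @^-1` [set (1 : G)]) //.
apply: preimage_clopen.
  by split; [exact: discrete_open | exact: discrete_closed].
move=> x; apply: continuous_comp; first exact: val_continuous.
exact: lcoord_continuous.
Qed.

(** A translate that already lies in the slice needs no correction by [H], so the slice action
    agrees there with [lact]. *)
Lemma base_slice_full (G H : groupType) (C : coupling G H) :
  (forall w : C, rcoord w = 1 :> H -> exists g,
     rcoord (lact g w) = 1 :> H /\ lcoord (lact g w) = 1 :> G) ->
  \bigcup_g ((act g : slice_system C -> slice_system C) @` base_slice C) =
  [set: slice_system C].
Proof.
move=> full; apply/seteqP; split=> // x _.
have [g [rg lg]] := full (val (x : slice C)) (set_valP x).
exists g^-1 => //; exists (act g x); last by rewrite actK.
by rewrite /base_slice /= to_slice_id.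
Qed.

(** * The isomorphism between the restrictions of the two slices *)

Section SliceIso.
Variables (G H : groupType) (C : coupling G H).
Let A := base_slice C.
Let B := base_slice (coupling_swap C).
Local Notation K := (restricted_groupoid A).
Local Notation L := (restricted_groupoid B).

Definition arrow_point (a : K) : C := val (val a).1.

Definition arrow_label (a : K) : G := (val a).2.

(* The element h with g^-1 . x = h^-1 (g^-1 x) in the slice; (x, g) |-> (x, h)
   is the groupoid isomorphism. *)
Definition arrow_colabel (a : K) : H :=
  rcoord (lact (arrow_label a)^-1 (arrow_point a)).

Lemma arrow_point_rcoord a : rcoord (arrow_point a) = 1 :> H.
Proof. exact: (set_valP ((val a).1 : slice C)). Qed.

Lemma arrow_point_lcoord a : lcoord (arrow_point a) = 1 :> G.
Proof. by have [] := set_valP a. Qed.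

Definition arrow_src (a : K) : slice C := @tg_src G (slice_system C) (val a).

Lemma arrow_srcE a : val (arrow_src a) =
  ract (arrow_colabel a)^-1 (lact (arrow_label a)^-1 (arrow_point a)).
Proof. by []. Qed.

Lemma arrow_src_lcoord a : lcoord (val (arrow_src a)) = 1 :> G.
Proof. by have [] := set_valP a. Qed.

(** The recipe for the colabel, applied in the swapped coupling, returns the label: the source
    [h^-1 g^-1 x] has [lcoord] 1, and [lcoord] is [G]-equivariant. Both inverse laws of the
    isomorphism rest on this. *)
Lemma arrow_colabelK a :
  lcoord (ract (arrow_colabel a)^-1 (arrow_point a)) = arrow_label a :> G.
Proof.
have := arrow_src_lcoord a; rewrite arrow_srcE -lract lcoord_lact => /eqP.
by rewrite mulg_eq1 => /eqP/invg_inj ->.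
Qed.

Lemma slice_obj_subproof (x : A) :
  slice (coupling_swap C) (val (val x : slice C)).
Proof. exact: (set_valP x). Qed.

Definition slice_obj_val (x : A) : slice_system (coupling_swap C) :=
  SigSub (mem_set (slice_obj_subproof x)).

Lemma slice_objP (x : A) : slice_obj_val x \in B.
Proof. by apply/mem_set; exact: (set_valP (val x : slice C)). Qed.

Definition slice_obj (x : A) : B := SigSub (slice_objP x).

Lemma slice_point_subproof a : slice (coupling_swap C) (arrow_point a).
Proof. exact: arrow_point_lcoord. Qed.

Definition slice_point (a : K) : slice_system (coupling_swap C) :=
  SigSub (mem_set (slice_point_subproof a)).

(** On the other slice [h^-1] is followed by a correction in [G], which is [g^-1] by
    [arrow_colabelK]; both sources are therefore [h^-1 g^-1 x]. *)
Lemma slice_arrow_src a :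
  val (act (arrow_colabel a)^-1 (slice_point a) : slice _) =
  val (arrow_src a).
Proof.
rewrite arrow_srcE /= /to_slice /= arrow_colabelK.
by rewrite lract.
Qed.

Lemma slice_arrowP a : (slice_point a, arrow_colabel a) \in
  @restr_set (transformation_groupoid (slice_system (coupling_swap C))) B.
Proof.
apply/mem_set; split; last exact: arrow_point_rcoord.
rewrite -[_ _]/(rcoord (val (act (arrow_colabel a)^-1 (slice_point a) :
  slice (coupling_swap C)) : C) = 1 :> H) slice_arrow_src.
exact: (set_valP (arrow_src a)).
Qed.

Definition slice_arrow (a : K) : L := SigSub (slice_arrowP a).

Lemma slice_arrow_continuous : continuous slice_arrow.
Proof.
have cpt : continuous arrow_point.
  move=> a; apply: (@continuous_comp _ _ _ (fun a : K => (val a).1)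
    (val : slice C -> C)); last exact: val_continuous.
  by apply: continuous_fst; exact: val_continuous.
apply: continuous_set_type; apply: continuous_pair.
  exact: continuous_set_type.
move=> a; apply: (@continuous_comp _ _ _
  (fun a => (arrow_point a, (arrow_label a : discrete_topology G)))
  (fun wg : C * discrete_topology G => rcoord (lact (wg.2 : G)^-1 wg.1))).
  apply: continuous_pair => //.
  by apply: continuous_snd; exact: val_continuous.
apply: continuous_prod_discrete => t w.
apply: (@continuous_comp _ _ _ (lact (t : G)^-1) (@rcoord _ _ C)).
  exact: lact_continuous.
exact: rcoord_continuous.
Qed.

Lemma slice_obj_continuous : continuous slice_obj.
Proof.
apply: continuous_set_type; apply: continuous_set_type => x.
by apply: continuous_comp; exact: val_continuous.
Qed.

Lemma slice_arrow_rng a : restr_rng (slice_arrow a) = slice_obj (restr_rng a).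
Proof. by do 2!apply: val_inj. Qed.

Lemma slice_arrow_srcE a :
  restr_src (slice_arrow a) = slice_obj (restr_src a).
Proof. by do 2!apply: val_inj; exact: slice_arrow_src. Qed.

(** The range of [b] is the source [h^-1 g^-1 x] of [a], so equivariance of [rcoord] splits [h^-1]
    off the colabel of [b], and colabels multiply as labels do. *)
Lemma slice_arrow_mul (a b : K) (ab : restr_src a = restr_rng b)
    (ab' : restr_src (slice_arrow a) = restr_rng (slice_arrow b)) :
  slice_arrow (restr_mul ab) = restr_mul ab'.
Proof.
apply: val_inj; congr (_, _); first exact: val_inj.
have pb : arrow_point b =
    ract (arrow_colabel a)^-1 (lact (arrow_label a)^-1 (arrow_point a)).
  rewrite -arrow_srcE.
  by move/(congr1 (fun x : A => val (val x : slice C))): ab.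
rewrite [RHS]/= [in RHS]/(arrow_colabel b) pb lract rcoord_ract mulVKg -lactM.
by rewrite -invgM.
Qed.

End SliceIso.

Lemma slice_arrowK (G H : groupType) (C : coupling G H) :
  cancel (@slice_arrow _ _ C) (@slice_arrow _ _ (coupling_swap C)).
Proof.
move=> a; apply: val_inj; rewrite [RHS]surjective_pairing.
by congr (_, _); [exact: val_inj | exact: arrow_colabelK].
Qed.

Lemma slice_arrowVK (G H : groupType) (C : coupling G H) :
  cancel (@slice_arrow _ _ (coupling_swap C)) (@slice_arrow _ _ C).
Proof.
move=> a; apply: val_inj; rewrite [RHS]surjective_pairing.
by congr (_, _); [exact: val_inj | exact: arrow_colabelK].
Qed.

Lemma slice_objK (G H : groupType) (C : coupling G H) :
  cancel (@slice_obj _ _ C) (@slice_obj _ _ (coupling_swap C)).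
Proof. by move=> x; do 2!apply: val_inj. Qed.

Lemma slice_objVK (G H : groupType) (C : coupling G H) :
  cancel (@slice_obj _ _ (coupling_swap C)) (@slice_obj _ _ C).
Proof. by move=> x; do 2!apply: val_inj. Qed.

Lemma slice_iso (G H : groupType) (C : coupling G H) :
  groupoid_isomorphic (restricted_groupoid (base_slice C))
    (restricted_groupoid (base_slice (coupling_swap C))).
Proof.
exists (@slice_arrow _ _ C), (@slice_obj _ _ C); split.
- split; first exact: slice_arrow_continuous.
  exists (@slice_arrow _ _ (coupling_swap C)).
  split; [exact: slice_arrow_continuous|exact: slice_arrowK|].
  exact: slice_arrowVK.
- split; first exact: slice_obj_continuous.
  exists (@slice_obj _ _ (coupling_swap C)).
  split; [exact: slice_obj_continuous|exact: slice_objK|].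
  exact: slice_objVK.
- exact: slice_arrow_rng.
- exact: slice_arrow_srcE.
- exact: slice_arrow_mul.
Qed.

Lemma coupling_kakutani (G H : groupType) (C : coupling G H) :
  (forall w : C, rcoord w = 1 :> H -> exists g,
     rcoord (lact g w) = 1 :> H /\ lcoord (lact g w) = 1 :> G) ->
  (forall w : C, lcoord w = 1 :> G -> exists h,
     lcoord (ract h w) = 1 :> G /\ rcoord (ract h w) = 1 :> H) ->
  kakutani_equivalent (slice_system C) (slice_system (coupling_swap C)).
Proof.
move=> fG fH; exists (base_slice C), (base_slice (coupling_swap C)).
split; [exact: clopen_base_slice|exact: clopen_base_slice| | |exact: slice_iso].
  exact: base_slice_full.
exact: (@base_slice_full _ _ (coupling_swap C)).
Qed.

(** The two slices are the same subset of [C], so each base slice is a whole system and the constant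
    maps 1 move every point into it. *)
Lemma coupling_orbit_equivalent (G H : groupType) (C : coupling G H) :
  (forall w : C, rcoord w = 1 :> H <-> lcoord w = 1 :> G) ->
  orbit_equivalent (slice_system C) (slice_system (coupling_swap C)).
Proof.
move=> rl.
have [||||p [q [pq /(_ (fun=> erefl) (fun=> erefl))[pK qK]]]] :=
  kakutani_couple (gamma := fun=> 1 : G) (delta := fun=> 1 : H) (slice_iso C).
- exact: cst_continuous.
- by move=> x; rewrite act1; apply/rl; exact: (set_valP (x : slice C)).
- exact: cst_continuous.
- move=> y; rewrite act1.
  by apply/rl; exact: (set_valP (y : slice (coupling_swap C))).
by exists p, q.
Qed.

(** * The hull of a subset of a group *)

Local Notation config I := (prod_topology (fun _ : I => bool)).

Section Config.
Variable I : choiceType.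
Implicit Types (w : config I) (s : seq I).

Lemma config_nbhs_coord w i : nbhs w [set w' : config I | w' i = w i].
Proof. exact: (@proj_continuous I (fun=> bool) i w [set w i]). Qed.

Lemma config_nbhs_seq w s :
  nbhs w [set w' : config I | forall i, i \in s -> w' i = w i].
Proof.
apply: (@near_finite _ I (nbhs w) [set` s] (fun i w' => w' i = w i)).
  exact: finite_seq.
by move=> i _; exact: config_nbhs_coord.
Qed.

Lemma config_nbhsP w U :
  nbhs w U ->
  exists s, [set w' : config I | forall i, i \in s -> w' i = w i] `<=` U.
Proof.
(* The filter of finite windows around [w]; its convergence to [w] is checked one coordinate at a
   time. *)
pose F : set_system (config I) :=
  filter_from [set: seq I]
    (fun s => [set w' : config I | forall i, i \in s -> w' i = w i]).
have FF : Filter F.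
  apply: filter_from_filter; first by exists [::].
  move=> s t _ _; exists (s ++ t) => // w' st.
  by split=> i ist; apply: st; rewrite mem_cat ist ?orbT.
have Fw : F --> w.
  apply/cvg_sup => i V [_ [[A oA <-] Aw AV]].
  exists [:: i] => // w' /(_ i (mem_head _ _)) w'i.
  by apply: AV; rewrite /= w'i.
by move=> /Fw[s _ sU]; exists s.
Qed.

(** Agreement on [s] is a symmetric relation, so the hypothesis passes to the complement of [P]. *)
Lemma config_cylinder_clopen s (P : set (config I)) :
  (forall w w', (forall i, i \in s -> w' i = w i) -> P w -> P w') -> clopen P.
Proof.
move=> PE; have oP (Q : set (config I)) :
    (forall w w', (forall i, i \in s -> w' i = w i) -> Q w -> Q w') -> open Q.
  move=> QE; rewrite openE => w Qw.
  by apply: filterS (config_nbhs_seq w s) => w' /QE; exact.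
split; first exact: oP.
rewrite -openC; apply: oP => w w' ww' nPw /PE Pw'.
by apply/nPw/Pw' => i si; rewrite ww'.
Qed.

Lemma config_continuous (X : topologicalType) (f : X -> config I) :
  (forall i x, \forall y \near x, f y i = f x i) -> continuous f.
Proof.
move=> cf x U /config_nbhsP[s sU].
have := @near_finite _ I (nbhs x) [set` s] (fun i y => f y i = f x i)
  (nbhs_filter x)  (finite_seq s) (fun i _ => cf i x).
by rewrite /fmap /=; apply: filterS => y fy; exact: sU.
Qed.

Lemma config_hausdorff : hausdorff_space (config I).
Proof.
apply: (@hausdorff_product I (fun=> bool)) => _; exact: discrete_hausdorff.
Qed.

Lemma config_compact : compact [set: config I].
Proof.
have := @tychonoff I (fun=> bool) (fun=> setT) (fun=> bool_compact).
by congr compact; apply/seteqP; split.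
Qed.

Lemma config_zero_dimensional : zero_dimensional (config I).
Proof.
by apply: (@zero_dimension_prod I (fun=> bool)) => _;
   exact: discrete_zero_dimension.
Qed.

Lemma config_second_countable :
  countable [set: I] -> @second_countable (config I).
Proof.
move=> /countable_injP[code codeI].
have {}codeI : injective code by move=> i j; apply: codeI; rewrite inE.
(* A cylinder is given by a finite list of coded coordinates with prescribed values, and there are
   countably many such lists. *)
pose cyl (t : seq (nat * bool)) : set (config I) :=
  [set w | forall i b, (code i, b) \in t -> w i = b].
exists (range cyl).
  by apply: sub_countable (card_image_le _ _) _; exact: countableP.
split=> [_ [t _ <-]|w U /config_nbhsP[s sU]].
  rewrite openE => w cw.
  have finD : finite_set [set i | code i \in unzip1 t].
    apply: (@finite_preimage _ _ [set` unzip1 t] code); last exact: finite_seq.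
    by move=> i j _ _; exact: codeI.
  have := @near_finite _ I (nbhs w) _ (fun i (w' : config I) => w' i = w i)
    (nbhs_filter w) finD (fun i _ => config_nbhs_coord w i).
  apply: filterS => w' ww' i b ibt; rewrite ww' ?(cw _ _ ibt) //=.
  by apply/mapP; exists (code i, b).
exists (cyl [seq (code i, w i) | i <- s]).
  split; first by exists [seq (code i, w i) | i <- s].
  by move=> i b /mapP[j js [/codeI-> ->]].
move=> w' cw'; apply: sU => i si; apply: cw'.
by apply/mapP; exists i.
Qed.

End Config.

Section Hull.
Variables (K : groupType) (W : set K).
Local Notation confK := (config (K * nat)%type).
Implicit Types w : confK.

Definition differences : set K := [set p.1 * p.2^-1 | p in W `*` W].

(* A configuration on K * nat encodes the subset {p | w (p, 0)} of K; the labels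
   w (p, n) with n > 0 are unconstrained and only serve to make the translation
   action topologically free. *)
Definition hull : set confK := [set w : confK |
  (forall p q, w (p, 0) -> w (q, 0) -> differences (p * q^-1)) /\
  (forall F : seq K, (forall p, W p -> exists2 q, q \in F & W (q * p)) ->
     forall p, w (p, 0) -> has (fun q => w (q * p, 0)) F)].

Definition marked (p : K) : set confK := [set w : confK | w (p, 0)].

(** A configuration without marked points satisfies both conditions of [hull] vacuously. Discarding
    these makes a first marked point available everywhere, but in general leaves the space only
    locally compact. *)
Definition pointed_hull : set confK := hull `&` \bigcup_p marked p.

Lemma clopen_marked p : clopen (marked p).
Proof.
apply: (@config_cylinder_clopen _ [:: (p, 0)]) => w w' ww'.
by rewrite /marked /= ww' ?mem_head.
Qed.

(** Both conditions are intersections of conditions on finitely many coordinates; in the second one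
    this is because [F] is a list. *)
Lemma closed_hull : closed hull.
Proof.
have -> : hull =
    \bigcap_(pq in [set pq : K * K | ~ differences (pq.1 * pq.2^-1)])
      ~` (marked pq.1 `&` marked pq.2) `&`
    \bigcap_(F in [set F : seq K |
        forall p, W p -> exists2 q, q \in F & W (q * p)])
      \bigcap_p [set w : confK | w (p, 0) -> has (fun q => w (q * p, 0)) F].
  apply/seteqP; split=> w.
    move=> [w1 w2]; split; first by move=> [p q] /= npq [wp wq]; exact/npq/w1.
    by move=> F FW p _ /=; exact: w2.
  move=> [w1 w2]; split=> [p q wp wq|F FW p].
    by apply: contrapT => npq; apply: (w1 (p, q) npq).
  exact: w2.
apply: closedI; [apply: closed_bigI => -[p q] _|apply: closed_bigI => F _].
  apply: open_closedC; apply: openI; first by case: (clopen_marked p).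
  by case: (clopen_marked q).
apply: closed_bigI => p _.
set S := [set w : confK | _]; suff [] : clopen S by [].
apply: (@config_cylinder_clopen _ ((p, 0) :: [seq (q * p, 0) | q <- F])).
move=> w w' ww'; rewrite /S /= => wF; rewrite ww' ?mem_head //.
move=> /wF/hasP[q qF wq]; apply/hasP; exists q => //.
by rewrite ww' // inE; apply/orP; right; apply/mapP; exists q.
Qed.

Lemma compact_hull_marked p : compact (hull `&` marked p).
Proof.
apply: (subclosed_compact _ (@config_compact _)) => //.
by apply: closedI; [exact: closed_hull | case: (clopen_marked p)].
Qed.

Lemma compact_pointed_marked p :
  compact ((val : pointed_hull -> confK) @^-1` marked p).
Proof.
have e : pointed_hull `&` marked p = hull `&` marked p.
  apply/seteqP; split=> w [hw wp]; first by case: hw.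
  by split=> //; split=> //; exists p.
by apply: compact_set_type; rewrite e; exact: compact_hull_marked.
Qed.

Definition shift (k : K) (w : confK) : confK := fun i => w (i.1 * k, i.2).

Lemma shift_continuous k : continuous (shift k).
Proof.
by apply: config_continuous => i w; exact: config_nbhs_coord.
Qed.

Lemma shift1 w : shift 1 w = w.
Proof. by apply/funext => -[p n]; rewrite /shift /= mulg1. Qed.

Lemma shiftM k l w : shift (k * l) w = shift k (shift l w).
Proof. by apply/funext => -[p n]; rewrite /shift /= mulgA. Qed.

(** Right translation preserves the quotients [p * q^-1] and commutes with the left multiplications
    in the second condition. *)
Lemma shift_hull k w : pointed_hull w -> pointed_hull (shift k w).
Proof.
move=> [[w1 w2] [p _ wp]]; split; last first.
  by exists (p * k^-1) => //; rewrite /marked /shift /= mulgVK.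
split=> [q r wq wr|F FW q wq].
  by have := w1 _ _ wq wr; rewrite /= mulgKA.
have /hasP[r rF wr] := w2 F FW _ wq; apply/hasP; exists r => //.
by rewrite /shift /= -mulgA.
Qed.

End Hull.

Section HullSpace.
Variables (K : groupType) (W : set K).
Local Notation confK := (config (K * nat)%type).
Local Notation space := (pointed_hull W : Type).
Implicit Types x : space.

Lemma hull_hausdorff : hausdorff_space (pointed_hull W).
Proof. exact/hausdorff_set_type/config_hausdorff. Qed.

Lemma hull_zero_dimensional : zero_dimensional (pointed_hull W).
Proof. exact/zero_dimensional_set_type/config_zero_dimensional. Qed.

Lemma hull_second_countable :
  countable [set: K] -> @second_countable (pointed_hull W).
Proof.
move=> cK; apply: second_countable_set_type; apply: config_second_countable.
by rewrite -setXTT; apply: countableX => //; exact: countableP.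
Qed.

Definition hull_marked (p : K) : set space :=
  (val : space -> confK) @^-1` marked p.

Lemma clopen_hull_marked p : clopen (hull_marked p).
Proof.
by apply: preimage_clopen; [exact: clopen_marked | exact: val_continuous].
Qed.

Lemma hull_marked_ex x : exists p, hull_marked p x.
Proof. by have [_ [p _ xp]] := set_valP x; exists p. Qed.

Lemma hull_marked_differences x p q :
  hull_marked p x -> hull_marked q x -> differences W (p * q^-1).
Proof. by have [[w1 _] _] := set_valP x; exact: w1. Qed.

Lemma hull_locally_compact : locally_compact [set: pointed_hull W].
Proof.
move=> x _; have [p xp] := hull_marked_ex x; exists (hull_marked p).
  rewrite within_interior; last exact: filterT.
  by apply: open_nbhs_nbhs; split=> //; case: (clopen_hull_marked p).
split; first exact: compact_pointed_marked.
by case: (clopen_hull_marked p).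
Qed.

Lemma hull_nonempty : W !=set0 -> [set: pointed_hull W] !=set0.
Proof.
move=> [p Wp].
(* The indicator of [W] itself, with all labels in positive layers false. *)
pose w : confK := fun i => (i.2 == 0) && `[< W i.1 >].
have wE q : w (q, 0) = `[< W q >] by [].
have hw : pointed_hull W w.
  split; last by exists p => //; rewrite /marked /= wE; exact/asboolP.
  split=> [q r|F FW q]; rewrite !wE.
    by move=> /asboolP Wq /asboolP Wr; exists (q, r).
  move=> /asboolP/FW[r rF Wr]; apply/hasP; exists r => //.
  by rewrite wE; exact/asboolP.
by exists (SigSub (mem_set hw)).
Qed.

Lemma hull_act_subproof k x : shift k (val x) \in pointed_hull W.
Proof. by apply/mem_set/shift_hull; exact: set_valP. Qed.

Definition hull_act k x : space := SigSub (hull_act_subproof k x).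

Lemma hull_act1 x : hull_act 1 x = x.
Proof. by apply: val_inj; rewrite /= shift1. Qed.

Lemma hull_actM k l x : hull_act (k * l) x = hull_act k (hull_act l x).
Proof. by apply: val_inj; rewrite /= shiftM. Qed.

Lemma hull_act_continuous k : continuous (hull_act k).
Proof.
apply: continuous_set_type => x.
apply: (@continuous_comp _ _ _ (val : space -> confK) (@shift K k)).
  exact: val_continuous.
exact: shift_continuous.
Qed.

Lemma hull_marked_act k p x :
  hull_marked p (hull_act k x) = hull_marked (p * k) x.
Proof. by []. Qed.

Lemma hull_act_free k : k <> 1 -> dense [set x : space | hull_act k x <> x].
Proof.
move=> /eqP k1 U [x Ux] oU; case: (oU) => V oV VU.
have Vx : nbhs (val x) V.
  by apply: open_nbhs_nbhs; split=> //; move: Ux; rewrite -VU.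
have [s sV] := config_nbhsP Vx.
pose n := (\max_(i <- s) i.2).+1.
pose w : confK := fun i => if i == (1, n) then ~~ (val x) (k, n) else (val x) i.
have w0 p : w (p, 0) = (val x) (p, 0) by rewrite /w xpair_eqE andbF.
have hw : pointed_hull W w.
  have [[x1 x2] [p _ xp]] := set_valP x; split; last first.
    by exists p => //; rewrite /marked /= w0.
  split=> [q r|F FW q]; rewrite !w0; first exact: x1.
  by move=> /(x2 F FW)/hasP[r rF xr]; apply/hasP; exists r; rewrite ?w0.
exists (SigSub (mem_set hw)); split.
  rewrite -VU; apply: sV => i si; suff : w i = val x i by [].
  rewrite /w; case: ifP => // /eqP ie.
  have := @leq_bigmax_seq _ s predT (fun i : K * nat => i.2) i si isT.
  by rewrite ie /= ltnn.
move=> /(congr1 (fun y : space => (val y) (1, n))) /=.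
by rewrite /shift /= mul1g /w eqxx xpair_eqE (negbTE k1) /=; case: (val x _).
Qed.

End HullSpace.

Lemma compact_bigcup (T : topologicalType) (I : choiceType) (D : set I)
    (F : I -> set T) :
  finite_set D -> (forall i, compact (F i)) -> compact (\bigcup_(i in D) F i).
Proof.
by move=> fD cF; rewrite -bigsetU_fset_set //; exact: bigsetU_compact.
Qed.

(** * Marked points of least rank *)

Section FirstMarked.
Variables (K I J : groupType) (W : set K) (pi : K -> I) (si : K -> J).
Variables (rk : I -> nat) (iota : I -> K).
Local Notation space := (pointed_hull W : Type).
Hypothesis piM : forall p q, pi (p * q) = pi p * pi q.
Hypothesis rkI : injective rk.
Hypothesis rk1 : rk 1 = 0.
Hypothesis pi_inj : forall r, differences W r -> pi r = 1 -> r = 1.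
Hypothesis pi_fin : forall g, finite_set (differences W `&` pi @^-1` [set g]).

Let pi1 : pi 1 = 1.
Proof. by apply: (mulIg (pi 1)); rewrite -piM !mul1g. Qed.

Let piV p : pi p^-1 = (pi p)^-1.
Proof. by apply: (mulIg (pi p)); rewrite -piM !mulVg. Qed.

Lemma hull_marked_unique (x : space) p q :
  hull_marked p x -> hull_marked q x -> pi p = pi q -> p = q.
Proof.
move=> xp xq e; apply: divg1_eq; apply: pi_inj.
  exact: hull_marked_differences xp xq.
by rewrite piM piV e mulgV.
Qed.

Definition first_marked (s : space -> discrete_topology K) :=
  continuous s /\ forall x, hull_marked (s x) x /\
    forall p, hull_marked p x -> (rk (pi (s x)) <= rk (pi p))%N.

Lemma first_marked_ex : exists s, first_marked s.
Proof.
apply: clopen_selection (rk \o pi) _ _ _ _ _.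
- exact: clopen_hull_marked.
- exact: hull_marked_ex.
- move=> x p q xp xq /rkI; exact: hull_marked_unique xp xq.
(* If [q] is marked together with [p], then [q p^-1] is a difference lying over [pi(q) pi(p)^-1].
   Finitely many values [pi q] have lower rank, and the differences over each of them are finite in
   number. *)
- move=> p; pose F g :=
    [set r * p | r in differences W `&` pi @^-1` [set g * (pi p)^-1]].
  have finF : finite_set (\bigcup_(g in [set g | (rk g < rk (pi p))%N]) F g).
    apply: bigcup_finite; first exact: finite_rank_lt.
    by move=> g _; apply: finite_image; exact: pi_fin.
  apply: sub_finite_set finF => q [qp [x [xp xq]]].
  exists (pi q) => //; exists (q * p^-1); last by rewrite mulgVK.
  by split; [exact: hull_marked_differences xq xp | rewrite /= piM piV].
Qed.

Section Selected.
Variable s : space -> discrete_topology K.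
Hypothesis sP : first_marked s.

Lemma first_marked_eq x p : hull_marked p x ->
  (forall q, hull_marked q x -> (rk (pi p) <= rk (pi q))%N) -> s x = p :> K.
Proof.
move=> xp minp; have [xs mins] := sP.2 x.
apply: (hull_marked_unique xs xp); apply: rkI.
by apply/eqP; rewrite eqn_leq mins // minp.
Qed.

(** Translation by [k] multiplies the marked points by [k^-1] on the right; as [pi k = 1] their
    ranks do not change, so the minimiser is carried along. *)
Lemma first_marked_act k x : pi k = 1 ->
  s (hull_act k x) = (s x : K) * k^-1 :> K.
Proof.
move=> k1; have [xs mins] := sP.2 x.
apply: first_marked_eq; first by rewrite hull_marked_act mulgVK.
move=> q; rewrite hull_marked_act => /mins.
by rewrite !piM piV k1 invg1 !mulg1.
Qed.

Lemma first_marked1 x : hull_marked 1 x -> s x = 1 :> K.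
Proof. by move=> x1; apply: first_marked_eq => // q _; rewrite pi1 rk1. Qed.

Lemma first_marked_pi1 x q :
  hull_marked q x -> pi q = 1 -> pi (s x : K) = 1.
Proof.
move=> xq q1; apply: rkI; rewrite rk1; apply/eqP; rewrite -leqn0.
by have [_ /(_ _ xq)] := sP.2 x; rewrite q1 rk1.
Qed.

(** The density of [W] is transported by the second condition of [hull]. For a marked [p], let [F]
    be the finite set of differences over [e (pi p)^-1] with [e] in [E]. Density at
    [(pi p)^-1 pi(q)] shows that [F] moves each [q] of [W] back into [W], so some [r * p] with [r]
    in [F] is marked, and it lies over [E]. *)
Lemma hull_dense (E : set I) : finite_set E ->
  (forall g, exists2 p, W p & exists2 e, E e & pi p = e * g) ->
  forall x : space, exists2 q, hull_marked q x & E (pi q).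
Proof.
move=> finE dW x; have [p xp] := hull_marked_ex x.
pose F : set K :=
  \bigcup_(e in E) (differences W `&` pi @^-1` [set e * (pi p)^-1]).
have [F' FE] : exists s : seq K, F = [set` s].
  by apply/finite_seqP; apply: bigcup_finite => // e _; exact: pi_fin.
have [[_ x2] _] := set_valP x.
have /hasP[r rF xr] : has (fun q => (val x) (q * p, 0)) F'.
  apply: x2 => // q Wq; have [q' Wq' [e Ee q'E]] := dW ((pi p)^-1 * pi q).
  exists (q' * q^-1); last by rewrite mulgVK.
  have : F (q' * q^-1).
    exists e => //; split; first by exists (q', q).
    by rewrite /= piM piV q'E mulgA mulgK.
  by rewrite FE.
have [e Ee [_ rE]] : F r by rewrite FE.
exists (r * p) => //; rewrite piM.
by move: rE => /= ->; rewrite mulgVK.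
Qed.

(** On this fibre [s x] is determined by its image under [pi], whose rank is at most that of some
    element of [E] by [hull_dense]. So [s x] ranges over a finite set [Q], and the fibre is closed
    in a finite union of the compact sets [hull_marked p]. *)
Lemma compact_first_marked (E : set I) : finite_set E ->
  (forall g, exists2 p, W p & exists2 e, E e & pi p = e * g) ->
  (forall p, si p = 1 -> p = iota (pi p)) ->
  compact [set x : space | si (s x : K) = 1].
Proof.
move=> finE dW siP.
pose Q : set K := \bigcup_(e in E) (iota @` [set g | (rk g < (rk e).+1)%N]).
have finQ : finite_set Q.
  apply: bigcup_finite => // e _; apply: finite_image; exact: finite_rank_lt.
have cQ : compact (\bigcup_(p in Q) @hull_marked K W p).
  exact: compact_bigcup finQ (@compact_pointed_marked K W).
apply: (subclosed_compact _ cQ).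
  have /continuous_closedP/(_ [set p : K | si p = 1]) := sP.1.
  by apply; exact: discrete_closed.
move=> x /= /siP sE; have [q xq Eq] := hull_dense finE dW x.
have [xs mins] := sP.2 x.
exists (s x) => //; exists (pi q) => //; exists (pi (s x : K)) => //=.
by rewrite ltnS mins.
Qed.

End Selected.
End FirstMarked.

(** * The coupling on the hull *)

Section HullCoupling.
Variables (G H : groupType) (W : set (G * H)).
Variables (s1 s2 : pointed_hull W -> discrete_topology (G * H)%type).
Variables (rkG : G -> nat) (rkH : H -> nat).
Hypothesis W0 : W !=set0.
Hypothesis rkGI : injective rkG.
Hypothesis rkHI : injective rkH.
Hypothesis rkG1 : rkG 1 = 0.
Hypothesis rkH1 : rkH 1 = 0.
Hypothesis fst_inj : forall r : G * H, differences W r -> r.1 = 1 -> r = 1.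
Hypothesis snd_inj : forall r : G * H, differences W r -> r.2 = 1 -> r = 1.
Hypothesis s1P : first_marked fst rkG s1.
Hypothesis s2P : first_marked snd rkH s2.

Let fstM (p q : G * H) : (p * q).1 = p.1 * q.1. Proof. by []. Qed.
Let sndM (p q : G * H) : (p * q).2 = p.2 * q.2. Proof. by []. Qed.

(** The choice [s2] depends on ranks of second coordinates, which [(g, 1)] preserves, so this
    translation multiplies [s2 x] by [(g, 1)^-1] on the right. The inverse turns this into left
    multiplication by [g]. The same holds for [rc] with the roles exchanged. *)
Let lc (x : pointed_hull W) : discrete_topology G := (s2 x : G * H).1^-1.
Let rc (x : pointed_hull W) : discrete_topology H := (s1 x : G * H).2^-1.

Let pair1M g g' : (g * g', 1) = (g, 1) * (g', 1) :> G * H.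
Proof. by congr pair; rewrite mulg1. Qed.

Let pairM1 h h' : (1, h * h') = (1, h) * (1, h') :> G * H.
Proof. by congr pair; rewrite mulg1. Qed.

Let pair_comm g h : (g, 1) * (1, h) = (1, h) * (g, 1) :> G * H.
Proof. by congr pair; rewrite mulg1 mul1g. Qed.

Let lc_continuous : continuous lc.
Proof.
apply/continuous_discreteP => x.
have /continuous_discreteP/(_ x) := s2P.1.
by apply: filterS => y; rewrite /lc => ->.
Qed.

Let rc_continuous : continuous rc.
Proof.
apply/continuous_discreteP => x.
have /continuous_discreteP/(_ x) := s1P.1.
by apply: filterS => y; rewrite /rc => ->.
Qed.

Let lc_act g x : lc (hull_act (g, 1) x) = g * (lc x : G) :> G.
Proof.
rewrite /lc (first_marked_act sndM rkHI snd_inj s2P) //=.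
by rewrite invgM invgK.
Qed.

Let rc_act h x : rc (hull_act (1, h) x) = h * (rc x : H) :> H.
Proof.
rewrite /rc (first_marked_act fstM rkGI fst_inj s1P) //=.
by rewrite invgM invgK.
Qed.

Definition hull_coupling : coupling G H.
Proof.
apply: (@Coupling G H (pointed_hull W) (fun g => hull_act (g, 1))
  (fun h => hull_act (1, h)) lc rc) => //.
- exact: hull_nonempty.
- exact: hull_hausdorff.
- exact: hull_locally_compact.
- exact: hull_act1.
- exact: hull_act1.
- by move=> g g' w; rewrite pair1M hull_actM.
- by move=> h h' w; rewrite pairM1 hull_actM.
- by move=> g h w; rewrite -!hull_actM pair_comm.
- by move=> g; exact: hull_act_continuous.
- by move=> h; exact: hull_act_continuous.
Defined.

Let hull_act2_free k l : k * l <> 1 ->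
  dense [set w : pointed_hull W | hull_act k (hull_act l w) <> w].
Proof.
move=> /(@hull_act_free _ W); congr dense.
by apply/funext => w; rewrite /mkset hull_actM.
Qed.

Lemma hull_coupling_topologically_free :
  topologically_free (slice_system hull_coupling) /\
  topologically_free (slice_system (coupling_swap hull_coupling)).
Proof.
split; apply: slice_topologically_free => k l k1; apply: hull_act2_free.
  by move=> /(congr1 fst) /=; rewrite mulg1.
by move=> /(congr1 snd) /=; rewrite mulg1.
Qed.

(** The identity has rank 0 in both coordinates, so once marked it is selected by both [s1] and
    [s2]. *)
Let marked1_coord (x : hull_coupling) : hull_marked 1 x ->
  rcoord x = 1 :> H /\ lcoord x = 1 :> G.
Proof.
move=> x1; split=> /=.
  by rewrite /rc (first_marked1 fstM rkGI rkG1 fst_inj s1P x1) invg1.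
by rewrite /lc (first_marked1 sndM rkHI rkH1 snd_inj s2P x1) invg1.
Qed.

Let rcoord1 (x : pointed_hull W) :
  (rc x = 1 :> H) <-> ((s1 x : G * H).2 = 1).
Proof.
by split=> [/eqP|e]; [rewrite invg_eq1 => /eqP | rewrite /rc e invg1].
Qed.

Let lcoord1 (x : pointed_hull W) :
  (lc x = 1 :> G) <-> ((s2 x : G * H).1 = 1).
Proof.
by split=> [/eqP|e]; [rewrite invg_eq1 => /eqP | rewrite /lc e invg1].
Qed.

Let rcoordE (x : hull_coupling) :
  rcoord x = 1 :> H -> (s1 x : G * H) = ((s1 x : G * H).1, 1).
Proof.
by rewrite /= /rc; case: (s1 x) => a b /= /eqP; rewrite invg_eq1 => /eqP ->.
Qed.

Let lcoordE (x : hull_coupling) :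
  lcoord x = 1 :> G -> (s2 x : G * H) = (1, (s2 x : G * H).2).
Proof.
by rewrite /= /lc; case: (s2 x) => a b /= /eqP; rewrite invg_eq1 => /eqP ->.
Qed.

(** When [rcoord w] is 1, the marked point [s1 w] has the form [(g, 1)]; translating by it marks the
    identity and puts [w] into both slices. The other side is symmetric. *)
Lemma hull_coupling_kakutani :
  kakutani_equivalent (slice_system hull_coupling)
    (slice_system (coupling_swap hull_coupling)).
Proof.
apply: coupling_kakutani => w.
  move=> /rcoordE sE; exists (s1 w : G * H).1; apply: marked1_coord.
  by rewrite hull_marked_act mul1g -sE; case: (s1P.2 w).
move=> /lcoordE sE; exists (s2 w : G * H).2; apply/and_comm.
apply: marked1_coord.
by rewrite hull_marked_act mul1g -sE; case: (s2P.2 w).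
Qed.

(** As [W] projects onto [G], density with [E] reduced to 1 makes the first coordinate of [s1 x]
    trivial. If [rcoord x] is 1 as well, then [s1 x] is the identity, which is thus marked, and
    [lcoord x] is 1. The converse uses the projection onto [H]. *)
Lemma hull_coupling_orbit_equivalent :
  (forall g, finite_set (differences W `&` fst @^-1` [set g])) ->
  (forall h, finite_set (differences W `&` snd @^-1` [set h])) ->
  (forall g, exists h, W (g, h)) -> (forall h, exists g, W (g, h)) ->
  orbit_equivalent (slice_system hull_coupling)
    (slice_system (coupling_swap hull_coupling)).
Proof.
move=> fst_fin snd_fin Wl Wr; apply: coupling_orbit_equivalent => x.
split=> [/[dup] rx /rcoordE sE|/[dup] lx /lcoordE sE].
  have [|g|q xq q1] := hull_dense fstM fst_fin (E := [set 1]) _ _ x.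
  - exact: finite_set1.
  - have [h gh] := Wl g; exists (g, h) => //; exists 1 => //.
    by rewrite mul1g.
  have := first_marked_pi1 rkGI rkG1 s1P xq q1 => e1.
  have [xs _] := s1P.2 x; move: xs; rewrite sE e1.
  by case/marked1_coord.
have [|h|q xq q1] := hull_dense sndM snd_fin (E := [set 1]) _ _ x.
- exact: finite_set1.
- have [g gh] := Wr h; exists (g, h) => //; exists 1 => //.
  by rewrite mul1g.
have := first_marked_pi1 rkHI rkH1 s2P xq q1 => e1.
have [xs _] := s2P.2 x; move: xs; rewrite sE e1.
by case/marked1_coord.
Qed.

Lemma hull_coupling_compact_left (E : set G) :
  (forall g, finite_set (differences W `&` fst @^-1` [set g])) ->
  finite_set E ->
  (forall g, exists2 p, W p & exists2 e, E e & p.1 = e * g) ->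
  compact [set: slice_system hull_coupling].
Proof.
move=> fst_fin finE dW.
have cS := compact_first_marked (si := snd) (iota := fun g => (g, 1)) fstM rkGI
  fst_fin s1P finE dW.
have /compact_set_type : compact (slice hull_coupling `&` setT).
  rewrite setIT (_ : slice hull_coupling =
      [set x : pointed_hull W | (s1 x : G * H).2 = 1]).
    by apply: cS => -[a b] /= ->.
  by apply/seteqP; split=> x sx; exact/rcoord1.
by rewrite preimage_setT.
Qed.

Lemma hull_coupling_compact_right (E : set H) :
  (forall h, finite_set (differences W `&` snd @^-1` [set h])) ->
  finite_set E ->
  (forall h, exists2 p, W p & exists2 e, E e & p.2 = e * h) ->
  compact [set: slice_system (coupling_swap hull_coupling)].
Proof.
move=> snd_fin finE dW.
have cS := compact_first_marked (si := fst) (iota := fun h => (1, h)) sndM rkHI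
  snd_fin s2P finE dW.
have /compact_set_type :
    compact (slice (coupling_swap hull_coupling) `&` setT).
  rewrite setIT (_ : slice (coupling_swap hull_coupling) =
      [set x : pointed_hull W | (s2 x : G * H).1 = 1]).
    by apply: cS => -[a b] /= ->.
  by apply/seteqP; split=> x sx; exact/lcoord1.
by rewrite preimage_setT.
Qed.

Lemma hull_coupling_tdsc : countable [set: G] -> countable [set: H] ->
  tdsc (slice_system hull_coupling) /\
  tdsc (slice_system (coupling_swap hull_coupling)).
Proof.
move=> cG cH.
have cK : countable [set: G * H] by rewrite -setXTT; exact: countableX.
split; split.
- apply/zero_dimension_totally_disconnected/zero_dimensional_set_type.
  exact: hull_zero_dimensional.
- exact/second_countable_set_type/hull_second_countable.
- apply/zero_dimension_totally_disconnected/zero_dimensional_set_type.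
  exact: hull_zero_dimensional.
- exact/second_countable_set_type/hull_second_countable.
Qed.

End HullCoupling.

(** * Coarse embeddings *)

Lemma rank_ex (G : groupType) : countable [set: G] ->
  exists2 rk : G -> nat, injective rk & rk 1 = 0.
Proof.
move=> /countable_injP[f finj].
(* The successor reserves rank 0 for the identity. *)
exists (fun g => if g == 1 then 0 else (f g).+1); last by rewrite eqxx.
move=> g h; case: eqP => [->|_]; case: eqP => [->|_] // [].
by apply: finj; rewrite inE.
Qed.

Lemma coarse_equivalence_embedding (G H : groupType) (phi : G -> H) :
  coarse_equivalence phi -> coarse_embedding phi.
Proof.
move=> [[_ cphi] [psi [[_ cpsi] psi_phi _]]] S; split; first exact: cphi.
move=> fS; have fT : finite_set
    [set st.1 * st.2^-1 | st in [set (phi st.1, phi st.2) | st in S]].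
  by rewrite image_comp.
have := cpsi _ fT; rewrite image_comp /= => fpsi.
set F := [set (psi \o phi) x * (id x)^-1 | x in [set: G]] in psi_phi.
(* [s t^-1] is the product of the inverse of [psi(phi s) s^-1], of [psi(phi s) psi(phi t)^-1] and of
   [psi(phi t) t^-1], each taken from a finite set. *)
pose F3 := [set uvw.1.1^-1 * uvw.1.2 * uvw.2 | uvw in
  F `*` [set psi (phi st.1) * (psi (phi st.2))^-1 | st in S] `*` F].
have fF3 : finite_set F3.
  by apply: finite_image; apply: finite_setX => //; exact: finite_setX.
apply: sub_finite_set fF3 => _ [[s t] Sst <-].
exists ((psi (phi s) * s^-1, psi (phi s) * (psi (phi t))^-1),
        psi (phi t) * t^-1).
  split; last by exists t.
  by split; [exists s | exists (s, t)].
by rewrite /= invgM invgK !mulgA !mulgVK.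
Qed.

Section CoarseSystems.
Variables (G H : groupType) (phi : G -> H).
Hypothesis cG : countable [set: G].
Hypothesis cH : countable [set: H].
Hypothesis cphi : coarse_embedding phi.

(** A chosen preimage of [h]; the default 1 occurs only off the range of [phi], and [rep] is applied
    below to values of [phi] alone. *)
Let rep (h : H) : G := xget 1 [set g | phi g = h].

Let repK g : phi (rep (phi g)) = phi g.
Proof. by have := @xgetPex _ 1 [set g' | phi g' = phi g]; apply; exists g. Qed.

(* Restricting phi to a section makes both projections injective on the graph,
   so that the first and second coordinates determine the marked points. *)
Definition section_graph : set (G * H) :=
  [set p | p.2 = phi p.1 /\ rep (phi p.1) = p.1].

Let graph_rep g : section_graph (rep (phi g), phi g).
Proof. by split; rewrite /= repK. Qed.

Let graph_inj p q : section_graph p -> section_graph q -> p.2 = q.2 -> p = q.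
Proof.
case: p q => [p1 p2] [q1 q2] [/= -> pE] [/= -> qE] e.
by rewrite -pE -qE e.
Qed.

Let graph_fst_inj r : differences section_graph r -> r.1 = 1 -> r = 1.
Proof.
move=> [[p q] [/= Wp Wq] <-] /= /divg1_eq pq; suff -> : p = q by rewrite mulgV.
by apply: graph_inj => //; rewrite Wp.1 Wq.1 pq.
Qed.

Let graph_snd_inj r : differences section_graph r -> r.2 = 1 -> r = 1.
Proof.
move=> [[p q] [/= Wp Wq] <-] /= /divg1_eq pq; suff -> : p = q by rewrite mulgV.
exact: graph_inj.
Qed.

(** The forward half of a coarse embedding, applied to all pairs with quotient [g]. *)
Let graph_fst_fin g :
  finite_set (differences section_graph `&` fst @^-1` [set g]).
Proof.
pose S := [set st : G * G | st.1 * st.2^-1 = g].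
have fS : finite_set [set phi st.1 * (phi st.2)^-1 | st in S].
  apply/cphi; apply: (sub_finite_set _ (finite_set1 g)).
  by move=> _ [st Sst <-].
apply: sub_finite_set (finite_image (fun h => (g, h)) fS).
move=> _ [[[p q] [/= Wp Wq] <-] /= e].
exists (phi p.1 * (phi q.1)^-1); first by exists (p.1, q.1).
by rewrite -Wp.1 -Wq.1 -e.
Qed.

(** The backward half of a coarse embedding, applied to all pairs whose images have quotient [h]. *)
Let graph_snd_fin h :
  finite_set (differences section_graph `&` snd @^-1` [set h]).
Proof.
pose S := [set st : G * G | phi st.1 * (phi st.2)^-1 = h].
have fS : finite_set [set st.1 * st.2^-1 | st in S].
  apply/cphi; apply: (sub_finite_set _ (finite_set1 h)).
  by move=> _ [st Sst <-].
apply: sub_finite_set (finite_image (fun g => (g, h)) fS).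
move=> _ [[[p q] [/= Wp Wq] <-] /= e].
exists (p.1 * q.1^-1); last by rewrite -e.
by exists (p.1, q.1) => //=; rewrite /S /= -Wp.1 -Wq.1.
Qed.

Lemma coarse_embedding_systems :
  exists (X : dynsys G) (Y : dynsys H), [/\
    [/\ topologically_free X, topologically_free Y, tdsc X & tdsc Y],
    compact [set: X], kakutani_equivalent X Y,
    coarse_equivalence phi -> compact [set: Y] &
    bijective phi -> orbit_equivalent X Y].
Proof.
have [rkG rkGI rkG1] := rank_ex cG; have [rkH rkHI rkH1] := rank_ex cH.
have W0 : section_graph !=set0 by exists (rep (phi 1), phi 1).
have fstM (p q : G * H) : (p * q).1 = p.1 * q.1 by [].
have sndM (p q : G * H) : (p * q).2 = p.2 * q.2 by [].
have [s1 s1P] := first_marked_ex fstM rkGI graph_fst_inj graph_fst_fin.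
have [s2 s2P] := first_marked_ex sndM rkHI graph_snd_inj graph_snd_fin.
pose C := hull_coupling W0 rkGI rkHI graph_fst_inj graph_snd_inj s1P s2P.
exists (slice_system C), (slice_system (coupling_swap C)); split.
- have [? ?] : topologically_free (slice_system C) /\
    topologically_free (slice_system (coupling_swap C)).
    exact: hull_coupling_topologically_free.
  have [? ?] : tdsc (slice_system C) /\ tdsc (slice_system (coupling_swap C)).
    exact: hull_coupling_tdsc.
  by [].
(* Quotients of elements with equal images form a finite set, and [rep (phi g)] differs from [g] by
   one of them; hence the domain of the graph is coarsely dense. *)
- pose S := [set st : G * G | phi st.1 = phi st.2].
  have finE : finite_set [set st.1 * st.2^-1 | st in S].
    apply/cphi; apply: (sub_finite_set _ (finite_set1 1)).
    by move=> _ [st Sst <-]; rewrite Sst mulgV.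
  apply: hull_coupling_compact_left graph_fst_fin finE _ => g.
  exists (rep (phi g), phi g) => //; exists (rep (phi g) * g^-1).
    by exists (rep (phi g), g) => //; exact: repK.
  by rewrite /= mulgVK.
- exact: hull_coupling_kakutani.
(* Closeness of [phi \o psi] to the identity makes the range of [phi] coarsely dense in [H]. *)
- move=> [_ [psi [_ _ phi_psi]]].
  apply: hull_coupling_compact_right graph_snd_fin phi_psi _ => h.
  exists (rep (phi (psi h)), phi (psi h)) => //.
  by exists (phi (psi h) * h^-1); [exists h | rewrite /= mulgVK].
- move=> [psi phiK psiK].
  (* For a bijection the section is everything, so the graph projects onto both groups. *)
  have repE g : rep (phi g) = g by apply: (can_inj phiK); exact: repK.
  apply: hull_coupling_orbit_equivalent => // [g|h].
    by exists (phi g); split=> //=.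
  by exists (psi h); split=> /=; rewrite ?psiK // -{1}(psiK h) repE.
Qed.

End CoarseSystems.

(** * The three equivalences *)

Theorem theorem2p17 (G H : groupType)
    (cG : countable [set: G]) (cH : countable [set: H]) :
  [/\ [/\ (exists phi : G -> H, coarse_embedding phi) <->
            exist_systems (fun (X : dynsys G) (Y : dynsys H) =>
              compact [set: X] /\ kakutani_equivalent X Y),
          (exists phi : G -> H, coarse_embedding phi) <->
            exist_systems (fun (X : dynsys G) (Y : dynsys H) =>
              compact [set: X] /\ has_orbit_couple X Y) &
          (exists phi : G -> H, coarse_embedding phi) ->
            exist_systems (fun (X : dynsys G) (Y : dynsys H) =>
              [/\ tdsc X, tdsc Y, compact [set: X] &
                  kakutani_equivalent X Y]) /\
            exist_systems (fun (X : dynsys G) (Y : dynsys H) =>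
              [/\ tdsc X, tdsc Y, compact [set: X] & has_orbit_couple X Y])],
      [/\ (exists phi : G -> H, coarse_equivalence phi) <->
            exist_systems (fun (X : dynsys G) (Y : dynsys H) =>
              [/\ compact [set: X], compact [set: Y] &
                  kakutani_equivalent X Y]),
          (exists phi : G -> H, coarse_equivalence phi) <->
            exist_systems (fun (X : dynsys G) (Y : dynsys H) =>
              [/\ compact [set: X], compact [set: Y] &
                  has_orbit_couple X Y]) &
          (exists phi : G -> H, coarse_equivalence phi) ->
            exist_systems (fun (X : dynsys G) (Y : dynsys H) =>
              [/\ tdsc X, tdsc Y, compact [set: X], compact [set: Y] &
                  kakutani_equivalent X Y]) /\
            exist_systems (fun (X : dynsys G) (Y : dynsys H) =>
              [/\ tdsc X, tdsc Y, compact [set: X], compact [set: Y] &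
                  has_orbit_couple X Y])] &
      ((exists phi : G -> H, bijective phi /\ coarse_equivalence phi) <->
         exist_systems (fun (X : dynsys G) (Y : dynsys H) =>
           [/\ compact [set: X], compact [set: Y] & orbit_equivalent X Y])) /\
      ((exists phi : G -> H, bijective phi /\ coarse_equivalence phi) ->
         exist_systems (fun (X : dynsys G) (Y : dynsys H) =>
           [/\ tdsc X, tdsc Y, compact [set: X], compact [set: Y] &
               orbit_equivalent X Y]))].
Proof.
have KC X Y := @kakutani_has_orbit_couple G H X Y cG cH.
split; [split|split|split]; [split| split| | split|split| |split|].
- move=> [phi ce].
  have [X [Y [[? ? _ _] ? ? _ _]]] := coarse_embedding_systems cG cH ce.
  by exists X, Y.
- move=> [X [Y [fX fY [cX /KC[p [q pq]]]]]].
  by have [phi [ce _ _]] := orbit_couple_coarse cG cH cX fX fY pq; exists phi.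
- move=> [phi ce].
  have [X [Y [[? ? _ _] ? /KC ? _ _]]] := coarse_embedding_systems cG cH ce.
  by exists X, Y.
- move=> [X [Y [fX fY [cX [p [q pq]]]]]].
  by have [phi [ce _ _]] := orbit_couple_coarse cG cH cX fX fY pq; exists phi.
- move=> [phi ce].
  have [X [Y [[? ? ? ?] ? kXY _ _]]] := coarse_embedding_systems cG cH ce.
  by split; exists X, Y; split=> //; split=> //; exact: KC.
- move=> [phi ce]; have [X [Y [[? ? _ _] ? ? /(_ ce) ? _]]] :=
    coarse_embedding_systems cG cH (coarse_equivalence_embedding ce).
  by exists X, Y.
- move=> [X [Y [fX fY [cX cY /KC[p [q pq]]]]]].
  have [phi [_ /(_ cY) ce _]] := orbit_couple_coarse cG cH cX fX fY pq.
  by exists phi.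
- move=> [phi ce]; have [X [Y [[? ? _ _] ? /KC ? /(_ ce) ? _]]] :=
    coarse_embedding_systems cG cH (coarse_equivalence_embedding ce).
  by exists X, Y.
- move=> [X [Y [fX fY [cX cY [p [q pq]]]]]].
  have [phi [_ /(_ cY) ce _]] := orbit_couple_coarse cG cH cX fX fY pq.
  by exists phi.
- move=> [phi ce]; have [X [Y [[? ? ? ?] ? kXY /(_ ce) ? _]]] :=
    coarse_embedding_systems cG cH (coarse_equivalence_embedding ce).
  by split; exists X, Y; split=> //; split=> //; exact: KC.
- move=> [phi [bphi ce]]; have [X [Y [[? ? _ _] ? _ /(_ ce) ? /(_ bphi) ?]]] :=
    coarse_embedding_systems cG cH (coarse_equivalence_embedding ce).
  by exists X, Y.
- move=> [X [Y [fX fY [cX cY [p [q [pq pK qK]]]]]]].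
  have [phi [_ /(_ cY) ce /(_ pK qK) bphi]] :=
    orbit_couple_coarse cG cH cX fX fY pq.
  by exists phi.
- move=> [phi [bphi ce]]; have [X [Y [[? ? ? ?] ? _ /(_ ce) ? /(_ bphi) ?]]] :=
    coarse_embedding_systems cG cH (coarse_equivalence_embedding ce).
  by exists X, Y.
Qed.
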